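(* Let $n\ge 2$ and let $L\subset\mathbb{R}^{2n-1}$ be a closed Legendrian submanifold all of whose Reeb chords $c$ have action $\mathcal{Z}(c)\ll 1$ (that is, less than some sufficiently small constant $\varepsilon>0$). Let $W$ be the Whitney embedding of the standard Legendrian unknot, with exactly one Reeb chord, of length $1$. Then the frontspinning $\Sigma L$ and the Legendrian product $W\times L$ are Legendrian isotopic in $\mathbb{R}^{2n+1}$.
   Context: Conventions: $\mathbb{R}^{2N+1}=\mathbb{R}^{2N}\times\mathbb{R}$ with coordinates $(x_i,y_i,z)$ has the contact form $dz-\sum y_i\,dx_i$ and Reeb field $\partial_z$. Legendrian submanifolds are $N$-dimensional submanifolds tangent to the contact hyperplanes. A Legendrian isotopy is a one-parameter family of embedded Legendrians. A Reeb chord $c$ is a vertical segment of positive length with both endpoints on the Legendrian; its action $\mathcal{Z}(c)$ is its length. Whitney unknot: $W\subset\mathbb{R}^3$ is the Legendrian lift of the exact Lagrangian immersion $S^1=\{(x,y)\in\mathbb{R}^2:x^2+y^2=1\}\to\mathbb{C}\simeq\mathbb{R}^2$, $(x,y)\mapsto c(1+iy)x$, with the constant $c>0$ chosen so that its unique Reeb chord has length $1$. It is Legendrian isotopic to the standard Legendrian unknot with $tb=-1$ and rotation number $0$. Legendrian product: for Legendrians $W\subset\mathbb{R}^{3}$ and $L\subset\mathbb{R}^{2n-1}$ with Lagrangian projections $\bar W\subset\mathbb{R}^2$, $\bar L\subset\mathbb{R}^{2n-2}$ (forget $z$), $W\times L\subset\mathbb{R}^{2n+1}$ is the Legendrian lift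 of $\bar W\times\bar L$, i.e. $\{(\bar w,\bar x,Z_W(w)+Z_L(x)):w\in W,\ x\in L\}$, with $Z_W,Z_L$ the $z$-coordinate functions. It is embedded if the sets of Reeb chord actions of $W$ and $L$ are disjoint. Frontspinning: the front projection of a Legendrian $L\subset\mathbb{R}^{2n-1}$ is its image $\{(x_1,\dots,x_{n-1},z)\}\subset\mathbb{R}^n$ under projection to the $x$- and $z$-coordinates; $L$ is recovered as the lift of its front, where the $y$-coordinates are determined by the contact condition. With $L$ translated so that $x_1>0$ on $L$, the frontspinning $\Sigma L\subset\mathbb{R}^{2n+1}$, of topological type $L\times S^1$, is the Legendrian lift of the subvariety $$\{(\cos\theta\,x_1(p),\ \sin\theta\,x_1(p),\ x_2(p),\dots,x_{n-1}(p),\ z(p)) : p\in L,\ \theta\in[0,2\pi]\}\subset\mathbb{R}^{n+1}.$$ *)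

(* Defs.v *)
From HB Require Import structures.
From mathcomp Require Import all_boot all_order all_algebra.
From mathcomp Require Import all_classical all_reals all_analysis.
Set Implicit Arguments.
Unset Strict Implicit.
Unset Printing Implicit Defensive.
Import Order.TTheory GRing.Theory Num.Theory.
Import numFieldNormedType.Exports.
Local Open Scope classical_set_scope.
Local Open Scope ring_scope.

(* Smooth maps between arbitrary subsets of Euclidean spaces, diffeomorphisms
   of such subsets, and submanifolds, following Milnor, "Topology from the
   differentiable viewpoint", section 1. *)

(* f is C^k on U; meant for U open and V, W finite dimensional. *)
Fixpoint Ck {R : realType} {V W : normedModType R} (k : nat) (U : set V)
    (f : V -> W) : Prop :=
  if k is k'.+1 then
    (forall x, U x -> differentiable f x) /\
    (forall v, Ck k' U (fun x => 'D_v f x))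
  else forall x, U x -> {for x, continuous f}.

Definition smooth_on {R : realType} {V W : normedModType R} (A : set V)
    (f : V -> W) : Prop :=
  forall x, A x -> exists (U : set V) (g : V -> W),
    [/\ open U, U x, forall k, Ck k U g & forall y, A y -> U y -> f y = g y].

Definition diffeomorphism {R : realType} {V W : normedModType R} (A : set V)
    (B : set W) (f : V -> W) : Prop :=
  [/\ smooth_on A f, f @` A = B &
      exists g : W -> V, smooth_on B g /\ forall x, A x -> g (f x) = x].

Definition submanifold {R : realType} {V : normedModType R} (m : nat)
    (M : set V) : Prop :=
  forall p, M p -> exists (O : set V) (U : set 'rV[R]_m) (phi : 'rV[R]_m -> V),
    [/\ open O, O p, open U & diffeomorphism U (M `&` O) phi].

Definition tangent {R : realType} {V : normedModType R} (M : set V)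
    (p v : V) : Prop :=
  exists (e : R) (gamma : R -> V),
    [/\ 0 < e, smooth_on `]- e, e[ gamma, forall t, - e < t < e -> M (gamma t),
        gamma 0 = p & 'D_1 gamma 0 = v].

(* R^(2N+1), a point being ((x, y), z); the Lagrangian projection is fst. *)
Notation contact_space R N := ('rV[R]_N * 'rV[R]_N * R)%type.

(* dz - sum_i y_i dx_i at p, evaluated on v *)
Definition contact_form {R : realType} {N : nat}
    (p v : contact_space R N) : R :=
  v.2 - \sum_(i < N) p.1.2 ord0 i * v.1.1 ord0 i.

Definition legendrian {R : realType} {N : nat}
    (Lam : set (contact_space R N)) : Prop :=
  submanifold N Lam /\
  forall p v, Lam p -> tangent Lam p v -> contact_form p v = 0.

Definition closed_legendrian {R : realType} {N : nat}
    (Lam : set (contact_space R N)) : Prop :=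
  legendrian Lam /\ compact Lam.

(* The family of embedded Legendrians is parametrized by its initial member. *)
Definition legendrian_isotopic {R : realType} {N : nat}
    (Lam0 Lam1 : set (contact_space R N)) : Prop :=
  exists F : R -> contact_space R N -> contact_space R N,
    [/\ smooth_on
          [set tp : R * contact_space R N | 0 <= tp.1 <= 1 /\ Lam0 tp.2]
          (fun tp => F tp.1 tp.2),
        forall t, 0 <= t <= 1 ->
          legendrian (F t @` Lam0) /\
          diffeomorphism Lam0 (F t @` Lam0) (F t),
        forall p, Lam0 p -> F 0 p = p &
        F 1 @` Lam0 = Lam1].

(* A Reeb chord is recorded by its lower and upper endpoints. *)
Definition reeb_chord {R : realType} {N : nat} (Lam : set (contact_space R N))
    (c : contact_space R N * contact_space R N) : Prop :=
  [/\ Lam c.1, Lam c.2, c.1.1 = c.2.1 & c.1.2 < c.2.2].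

Definition action {R : realType} {N : nat}
    (c : contact_space R N * contact_space R N) : R := c.2.2 - c.1.2.

(* Lam is a Legendrian lift of the immersion f of A into R^2N; lifts are unique
   up to translation in z when A is connected. *)
Definition legendrian_lift {R : realType} {V : normedModType R} {N : nat}
    (A : set V) (f : V -> 'rV[R]_N * 'rV[R]_N)
    (Lam : set (contact_space R N)) : Prop :=
  legendrian Lam /\
  exists h : V -> R, smooth_on A h /\ Lam = [set (f a, h a) | a in A].

Definition unit_circle {R : realType} : set (R * R) :=
  [set p | p.1 ^+ 2 + p.2 ^+ 2 = 1].

(* (x, y) |-> c (1 + i y) x, with real part in the x-coordinate of R^2 and
   imaginary part in the y-coordinate *)
Definition whitney_immersion {R : realType} (c : R) (p : R * R) :
    'rV[R]_1 * 'rV[R]_1 :=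
  (\row__ (c * p.1), \row__ (c * (p.2 * p.1))).

Definition whitney_unknot {R : realType} (W : set (contact_space R 1)) : Prop :=
  exists2 c : R, 0 < c &
    [/\ legendrian_lift unit_circle (whitney_immersion c) W,
        exists! d, reeb_chord W d &
        forall d, reeb_chord W d -> action d = 1].

Definition legendrian_product {R : realType} {M N : nat}
    (W : set (contact_space R M)) (L : set (contact_space R N)) :
    set (contact_space R (M + N)) :=
  [set q | exists w l, [/\ W w, L l &
    q = (row_mx w.1.1 l.1.1, row_mx w.1.2 l.1.2, w.2 + l.2)]].

Definition translate_x1 {R : realType} {k : nat} (a : R)
    (p : contact_space R k.+1) : contact_space R k.+1 :=
  (p.1.1 + a *: delta_mx ord0 ord0, p.1.2, p.2).

(* (u_1, ..., u_(k+1)) |->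
     (cos theta u_1, sin theta u_1, u_2, ..., u_(k+1)) *)
Definition spin {R : realType} {k : nat} (theta : R) (u : 'rV[R]_k.+1) :
    'rV[R]_k.+2 :=
  row_mx (\row_(_ < 1) (cos theta * u ord0 ord0))
         (\row_(j < k.+1)
            (if j == ord0 then sin theta * u ord0 ord0 else u ord0 j)).

(* The x- and z-coordinates are those of the spun front.  Writing
   X = spin theta x, one has
     cos theta dX_1 + sin theta dX_2 = dx_1,
     cos theta dX_2 - sin theta dX_1 = x_1 dtheta,
   so for x_1 > 0 the covector Y with Y dX = y dx, which is what the contact
   condition dz = Y dX asks for since dz = y dx on L, is Y = spin theta y. *)
Definition frontspin {R : realType} {k : nat} (L : set (contact_space R k.+1)) :
    set (contact_space R k.+2) :=
  [set q | exists p theta, [/\ L p, 0 <= theta <= 2 * pi &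
    q = (spin theta p.1.1, spin theta p.1.2, p.2)]].

(* Main.v *)
From HB Require Import structures.
Require Import Defs.
From mathcomp Require Import all_boot all_order all_algebra.
From mathcomp Require Import all_classical all_reals all_analysis.
From mathcomp Require Import ring lra.
Import Order.TTheory GRing.Theory Num.Theory.
Import numFieldNormedType.Exports.
Local Open Scope classical_set_scope.
Local Open Scope ring_scope.

(** All isotopies below are explicit families of embeddings of one manifold, the
    unit circle times [L].  Let [p = (p_1, p_2)] be the point of the circle and
    [u = x_1], [v = y_1] on [L]; only [p], [u], [v] enter the formulas, the other
    coordinates of [L] are carried along ([suspend]).

    The heart is the family [unwind s].  Up to scale the Whitney unknot is
    generated by [F (x; eta) = x ^ 2 * eta / 2 + eta ^ 3 / 6 - eta / 2]: it is the
    set of points [(x, F_x, F)] with [F_eta = 0], which is the circle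
    [x ^ 2 + eta ^ 2 = 1].  If [z = g (x)] is the front of [L], the product is
    generated by [F (x_1; eta) + g (x_2)], and this is deformed through
    [F (x_1; eta) + g (x_2 - s * eta)].  As soon as [s > 0] the parameter [eta] is
    visible in the position [x_2], and the circle, now embedded in the
    [(x_1, x_2)] plane, can be flattened by the contact shear
    [y -= dF (x_1, x_2)], [z -= F (x_1, x_2)].  What remains is a Legendrian
    near the flat round circle in which [L] sits radially, turned by a right
    angle: a frontspinning.  This works for small [L] only; the
    elimination in [unwind_opposite] shows that two points can collide only if
    their heights on [L] differ by at least about two thirds, the length of the
    chord of [F].

    At both ends room has to be made for this.  At the product end [L] is shrunk
    by contact dilations ([product_isotopy]); the product stays embedded because
    no dilate of a chord of [L] reaches the length of the chord of [W], which
    holds if all chords of [L] are shorter than [1].  At the spun end [L] is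
    turned by a right angle and shrunk while its centre moves away from the axis
    ([spin_isotopy], [spin_radius_gt0]); spinning a Legendrian that stays off the
    axis never creates double points.

    Two general facts turn the formulas into isotopies.  By [isotopy_of_family]
    it is enough that each member of the family is injective, has smooth left
    inverses near each parameter, and pulls the contact form back to zero on
    curves; compactness does the rest.  By [legendrian_isotopic_trans] isotopies
    can be concatenated, after slowing them down with a flat function.  Finally
    the contact condition determines the height function on [W]
    ([whitney_height]) and the length of its chord determines the scale
    ([whitney_scale]), so that the product in the statement is the one in the
    formulas. *)

Set Implicit Arguments.
Unset Strict Implicit.

(** * Calculus of smooth maps *)

Lemma near_eq_differentiable {R : realType} {V W : normedModType R}
    {f g : V -> W} {x : V} :
  {near x, f =1 g} -> differentiable f x -> differentiable g x.
Proof.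
move=> fg df.
have gE : g \o shift x = cst (g x) + 'd f x +o_ 0 id.
  apply/eqaddoP => e e0.
  have := diff_locally df => /eqaddoP /(_ e e0) h.
  have fg0 : \forall y \near 0, f (y + x) = g (y + x).
    by move: fg; rewrite (near_shift 0 x) /=; apply: filterS => y; rewrite /= subr0.
  rewrite -(nbhs_singleton fg).
  near=> y.
  suff -> : (g \o shift x - (cst (f x) + 'd f x)) y =
            (f \o shift x - (cst (f x) + 'd f x)) y by near: y.
  by rewrite !fctE /= /shift; congr (_ - _); apply/esym; near: y.
by apply/diff_locallyP; have -> := diff_unique (diff_continuous df) gE; split => //; exact: diff_continuous df.
Unshelve. all: by end_near. Qed.

Lemma open_near {R : realType} {V : normedModType R} {U : set V} {P : V -> Prop} x :
  open U -> U x -> (forall y, U y -> P y) -> \forall y \near x, P y.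
Proof. by move=> oU Ux UP; apply: filterS UP _; exact: open_nbhs_nbhs. Qed.

Lemma near_open {R : realType} {V : normedModType R} {P : V -> Prop} x :
  (\forall y \near x, P y) ->
  exists U : set V, [/\ open U, U x & forall y, U y -> P y].
Proof.
move=> Px; have : nbhs x [set y | P y] by [].
by rewrite nbhsE => -[U [oU Ux] UP]; exists U.
Qed.

Section Ck.
Context {R : realType}.

Lemma Ck_ext {V W : normedModType R} k (U : set V) (f g : V -> W) :
  open U -> (forall x, U x -> f x = g x) -> Ck k U f -> Ck k U g.
Proof.
move=> oU; elim: k f g => [|k IH] f g fg /=.
  move=> cf x Ux; have := cf x Ux.
  rewrite /prop_for /continuous_at -(fg _ Ux) => cfx; apply: cvg_trans cfx.
  by apply: near_eq_cvg; apply: (open_near oU Ux) => y Uy /=; rewrite fg.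
move=> [df cf]; split=> [x Ux|v].
  by apply: near_eq_differentiable (df x Ux); apply: (open_near oU Ux) => y Uy /=; rewrite fg.
apply: IH (cf v) => x Ux; apply: near_eq_derive.
by apply: (open_near oU Ux) => y Uy /=; rewrite fg.
Qed.

Lemma Ck_sub {V W : normedModType R} k (U U' : set V) (f : V -> W) :
  U' `<=` U -> Ck k U f -> Ck k U' f.
Proof.
move=> UU'; elim: k f => [|k IH] f /=; first by move=> cf x /UU'; exact: cf.
by move=> [df cf]; split=> [x /UU'|v]; [exact: df|exact: IH].
Qed.

Lemma CkS {V W : normedModType R} k (U : set V) (f : V -> W) :
  Ck k.+1 U f -> Ck k U f.
Proof.
elim: k f => [|k IH] f; last by move=> [df cf]; split=> // v; exact: IH.
by move=> [df _] x Ux; apply: differentiable_continuous; exact: df.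
Qed.

Lemma Ck_derivable {V W : normedModType R} k (U : set V) (f : V -> W) x v :
  Ck k.+1 U f -> U x -> derivable f x v.
Proof. by move=> [df _] Ux; apply: diff_derivable; exact: df. Qed.

Lemma Ck_diff {V W : normedModType R} k (U : set V) (f : V -> W) x :
  Ck k.+1 U f -> U x -> differentiable f x.
Proof. by move=> [df _]; exact: df. Qed.

Lemma Ck_derive {V W : normedModType R} k (U : set V) (f : V -> W) v :
  Ck k.+1 U f -> Ck k U (fun x => 'D_v f x).
Proof. by move=> [_ cf]; exact: cf. Qed.

Lemma Ck_cst {V W : normedModType R} k (U : set V) (a : W) :
  Ck k U (fun=> a).
Proof.
elim: k a => [|k IH] a /=; first by move=> x _; exact: cst_continuous.
split=> [x _|v]; first exact: differentiable_cst.
suff -> : (fun x : V => 'D_v (fun=> a) x) = fun=> 0 by exact: IH.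
by apply/funext => x; exact: derive_cst.
Qed.

Lemma CkD {V W : normedModType R} k (U : set V) (f g : V -> W) : open U ->
  Ck k U f -> Ck k U g -> Ck k U (fun x => f x + g x).
Proof.
move=> oU; elim: k f g => [|k IH] f g /=.
  by move=> cf cg x Ux; apply: cvgD; [exact: cf|exact: cg].
move=> [df cf] [dg cg]; split=> [x Ux|v].
  by apply: differentiableD; [exact: df|exact: dg].
apply: (@Ck_ext _ _ _ _ (fun x => 'D_v f x + 'D_v g x)) => //; last exact: IH.
move=> x Ux; rewrite -deriveD//; apply: diff_derivable; [exact: df|exact: dg].
Qed.

Lemma Ck_lin {V W : normedModType R} k (U : set V) (f : {linear V -> W}) :
  continuous f -> Ck k U f.
Proof.
move=> cf; case: k => [|k] /=; first by move=> x _; exact: cf.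
have df x : differentiable f x by exact: linear_differentiable.
split=> // v; suff -> : (fun x => 'D_v f x) = fun=> f v by exact: Ck_cst.
by apply/funext => x; rewrite deriveE// diff_lin.
Qed.

Lemma CkM {V : normedModType R} k (U : set V) (f g : V -> R) : open U ->
  Ck k U f -> Ck k U g -> Ck k U (fun x => f x * g x).
Proof.
move=> oU; elim: k f g => [|k IH] f g.
  by move=> cf cg x Ux; apply: cvgM; [exact: cf|exact: cg].
move=> Cf Cg; split=> [x Ux|v].
  by apply: differentiableM; [exact: Ck_diff Cf Ux|exact: Ck_diff Cg Ux].
apply: (@Ck_ext _ _ _ _ (fun x => f x * 'D_v g x + g x * 'D_v f x)) => //.
  move=> x Ux.
  by rewrite (deriveM (Ck_derivable Cf Ux) (Ck_derivable Cg Ux)).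
by apply: CkD => //; apply: IH; by [exact: CkS|exact: Ck_derive].
Qed.

Lemma CkV {V : normedModType R} k (U : set V) (f : V -> R) : open U ->
  (forall x, U x -> f x != 0) -> Ck k U f -> Ck k U (fun x => (f x)^-1).
Proof.
move=> oU f0; elim: k => [|k IH].
  by move=> cf x Ux; apply: cvgV; [exact: f0|exact: cf].
move=> Cf; split=> [x Ux|v].
  by apply: differentiableV; [exact: Ck_diff Cf Ux|exact: f0].
apply: (@Ck_ext _ _ _ _ (fun x => -1 * ((f x)^-1 * (f x)^-1) * 'D_v f x)) => //.
  move=> x Ux; rewrite (deriveV (f0 x Ux) (Ck_derivable Cf Ux)).
  by rewrite expr2 invfM mulN1r.
apply: CkM => //; last exact: Ck_derive.
apply: CkM => //; first exact: Ck_cst.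
by apply: CkM => //; apply: IH; exact: CkS.
Qed.

Lemma derive_comp1 {V : normedModType R} (g : R -> R) (f : V -> R) x v dg :
  differentiable f x -> is_derive (f x) 1 g dg ->
  'D_v (g \o f) x = dg * 'D_v f x.
Proof.
move=> df dgf; have [dg' dgE] := dgf.
have dg1 : differentiable g (f x) by apply/derivable1_diffP.
rewrite (deriveE _ (differentiable_comp df dg1)) (diff_comp df dg1) /comp.
by rewrite (diff1E dg1) derive1E dgE (deriveE _ df) mulrC.
Qed.

Lemma Ck_sqrt {V : normedModType R} k (U : set V) (f : V -> R) : open U ->
  (forall x, U x -> 0 < f x) -> Ck k U f -> Ck k U (fun x => Num.sqrt (f x)).
Proof.
move=> oU f0; elim: k => [|k IH].
  move=> cf x Ux; apply: continuous_comp; first exact: cf.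
  exact: sqrt_continuous.
move=> Cf.
have ds x : U x -> is_derive (f x) 1 Num.sqrt (2 * Num.sqrt (f x))^-1.
  by move=> Ux; apply: is_derive1_sqrt; exact: f0.
split=> [x Ux|v].
  apply: differentiable_comp; first exact: Ck_diff Cf Ux.
  by apply/derivable1_diffP; have [] := ds x Ux.
apply: (@Ck_ext _ _ _ _ (fun x => (2 * Num.sqrt (f x))^-1 * 'D_v f x)) => //.
  move=> x Ux.
  by rewrite (derive_comp1 v (Ck_diff Cf Ux) (ds x Ux)).
apply: CkM => //; last exact: Ck_derive.
apply: CkV => //.
  by move=> x Ux; rewrite mulf_neq0// gt_eqF// sqrtr_gt0 f0.
by apply: CkM => //; [exact: Ck_cst|apply: IH; exact: CkS].
Qed.


Lemma scale_continuous (W : normedModType R) :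
  continuous (fun p : R * W => p.1 *: p.2).
Proof. by move=> [a w]; apply: cvgZ; [exact: cvg_fst|exact: cvg_snd]. Qed.

Lemma scale_is_bilinear (W : normedModType R) :
  bilinear_for
    (GRing.Scale.Law.clone _ _ *:%R _) (GRing.Scale.Law.clone _ _ *:%R _)
    (@GRing.scale R W).
Proof.
split=> [u'|u] a x y /=.
- by rewrite scalerDl scalerA.
- by rewrite scalerDr !scalerA mulrC.
Qed.

End Ck.

HB.instance Definition _ (R : realType) (W : normedModType R) :=
  bilinear_isBilinear.Build R R W W _ _ (@GRing.scale R W)
    (@scale_is_bilinear R W).

Section Ck_comp.
Context {R : realType}.

Lemma differentiable_scale {V W : normedModType R} (f : V -> R) (g : V -> W) x :
  differentiable f x -> differentiable g x ->
  differentiable (fun y => f y *: g y) x.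
Proof.
move=> df dg.
apply: (@differentiable_comp _ _ _ _ (fun y => (f y, g y))
  (fun p => p.1 *: p.2)); first exact: differentiable_pair.
by apply: differentiable_bilin; exact: scale_continuous.
Qed.

Lemma derive_scale {V W : normedModType R} (f : V -> R) (g : V -> W) x v :
  differentiable f x -> differentiable g x ->
  'D_v (fun y => f y *: g y) x = f x *: 'D_v g x + 'D_v f x *: g x.
Proof.
move=> df dg; rewrite (deriveE _ df) (deriveE _ dg) (deriveE _ (differentiable_scale df dg)).
have dp : differentiable (fun y => (f y, g y)) x by exact: differentiable_pair.
have cs := @scale_continuous R W.
have db := differentiable_bilin (f x, g x) cs.
have := diff_comp dp db; rewrite /comp /= => ->.
by rewrite (diff_bilin (f x, g x) cs) /= diff_pair.
Qed.

Lemma CkZ {V W : normedModType R} k (U : set V) (f : V -> R) (g : V -> W) :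
  open U -> Ck k U f -> Ck k U g -> Ck k U (fun x => f x *: g x).
Proof.
move=> oU; elim: k f g => [|k IH] f g.
  by move=> cf cg x Ux; apply: cvgZ; [exact: cf|exact: cg].
move=> Cf Cg; split=> [x Ux|v].
  by apply: differentiable_scale; [exact: Ck_diff Cf Ux|exact: Ck_diff Cg Ux].
apply: (@Ck_ext _ _ _ _ _ (fun x => f x *: 'D_v g x + 'D_v f x *: g x)) => //.
  by move=> x Ux; rewrite (derive_scale _ (Ck_diff Cf Ux) (Ck_diff Cg Ux)).
by apply: CkD => //; apply: IH; by [exact: CkS|exact: Ck_derive].
Qed.

Lemma Ck_sum {V W : normedModType R} k (U : set V) (I : finType)
    (F : I -> V -> W) : open U ->
  (forall i, Ck k U (F i)) -> Ck k U (fun x => \sum_i F i x).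
Proof.
move=> oU CF; elim: (index_enum I) => [|i r IH].
  apply: (Ck_ext oU _ (@Ck_cst _ _ _ k U 0)) => x Ux.
  by rewrite big_nil.
by apply: (Ck_ext oU _ (CkD oU (CF i) IH)) => x Ux; rewrite big_cons.
Qed.

Lemma Ck_lcomp {V W X : normedModType R} k (U : set V) (l : {linear W -> X})
    (f : V -> W) : open U -> continuous l -> Ck k U f -> Ck k U (fun x => l (f x)).
Proof.
move=> oU cl; elim: k f => [|k IH] f.
  by move=> cf x Ux; apply: continuous_comp; [exact: cf|exact: cl].
have dl x : differentiable l x by exact: linear_differentiable.
move=> Cf; split=> [x Ux|v].
  by apply: differentiable_comp; [exact: Ck_diff Cf Ux|exact: dl].
apply: (Ck_ext oU _ (IH _ (Ck_derive v Cf))) => x Ux.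
have df := Ck_diff Cf Ux.
rewrite [RHS](deriveE _ (differentiable_comp df (dl (f x)))).
by rewrite (diff_comp df (dl (f x))) diff_lin//= (deriveE _ df).
Qed.

(** The chain rule differentiates [g] at [f x] in the direction ['D_v f x],
    which varies with [x], whereas [Ck] only knows derivatives in fixed
    directions.  A finite family spanning the middle space, with continuous
    coordinates, turns the former into a combination of the latter. *)
Definition finite_dim (W : normedModType R) : Prop :=
  exists (I : finType) (e : I -> W) (l : I -> {linear W -> R}),
    (forall i, continuous (l i)) /\ forall w, w = \sum_i l i w *: e i.

Lemma Ck_comp {V W X : normedModType R} k (U : set V) (U' : set W)
    (f : V -> W) (g : W -> X) : finite_dim W -> open U -> open U' ->
  (forall x, U x -> U' (f x)) -> Ck k U f -> Ck k U' g ->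
  Ck k U (fun x => g (f x)).
Proof.
move=> [I [e [l [cl le]]]] oU oU' UU'; elim: k g => [|k IH] g Cf Cg.
  by move=> x Ux; apply: continuous_comp; [exact: Cf|apply: Cg; exact: UU'].
split=> [x Ux|v].
  apply: differentiable_comp; first exact: Ck_diff Cf Ux.
  exact: Ck_diff Cg (UU' _ Ux).
apply: (@Ck_ext _ _ _ _ _
  (fun x => \sum_i l i ('D_v f x) *: 'D_(e i) g (f x))) => //.
  move=> x Ux; have df := Ck_diff Cf Ux; have dg := Ck_diff Cg (UU' _ Ux).
  rewrite [RHS](deriveE _ (differentiable_comp df dg)) (diff_comp df dg) /=.
  rewrite -(deriveE _ df).
  rewrite [in RHS](le ('D_v f x)) linear_sum; apply: eq_bigr => i _.
  by rewrite linearZ /= (deriveE _ dg).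
apply: Ck_sum => // i; apply: CkZ => //; first exact/Ck_lcomp/Ck_derive.
exact: (IH (fun y => 'D_(e i) g y) (CkS Cf) (Ck_derive (e i) Cg)).
Qed.

Lemma finite_dimR : finite_dim R.
Proof.
exists 'I_1, (fun=> 1), (fun=> idfun); split=> [_ x|w]; first exact: cvg_id.
by rewrite big_ord1 /= [_ *: _]mulr1.
Qed.

Lemma finite_dim_rV n : finite_dim 'rV[R]_n.
Proof.
have cl (j : 'I_n) : linear (fun w : 'rV[R]_n => w ord0 j).
  by move=> a u v; rewrite !mxE.
pose l j : {linear 'rV[R]_n -> R} :=
  HB.pack (fun w : 'rV[R]_n => w ord0 j)
    (GRing.isLinear.Build _ _ _ _ _ (cl j)).
exists 'I_n, (fun j => delta_mx ord0 j), l; split=> [j|w].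
  exact: coord_continuous.
exact: row_sum_delta.
Qed.

Lemma finite_dimX (V W : normedModType R) :
  finite_dim V -> finite_dim W -> finite_dim (V * W)%type.
Proof.
move=> [I [e [l [cl le]]]] [J [f [m [cm me]]]].
have ll i : linear (fun p : V * W => l i p.1).
  by move=> a u v; rewrite /= linearP.
have lm j : linear (fun p : V * W => m j p.2).
  by move=> a u v; rewrite /= linearP.
pose L (k : I + J) : {linear (V * W)%type -> R} := match k with
  | inl i => HB.pack (fun p : V * W => l i p.1)
      (GRing.isLinear.Build _ _ _ _ _ (ll i))
  | inr j => HB.pack (fun p : V * W => m j p.2)
      (GRing.isLinear.Build _ _ _ _ _ (lm j)) end.
exists (I + J)%type, (fun k => match k with inl i => (e i, 0) | inr j => (0, f j) end), L.
split=> [[i|j]|[v w]].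
- by move=> [x y]; apply: continuous_comp; [exact: cvg_fst|exact: cl].
- by move=> [x y]; apply: continuous_comp; [exact: cvg_snd|exact: cm].
have fstS (K : finType) (F : K -> V * W) : (\sum_k F k).1 = \sum_k (F k).1.
  by apply: (big_morph fst).
have sndS (K : finType) (F : K -> V * W) : (\sum_k F k).2 = \sum_k (F k).2.
  by apply: (big_morph snd).
rewrite big_sumType /=; apply/esym/eqP; rewrite xpair_eqE !fstS !sndS /=.
rewrite [X in _ + X == v]big1 => [|j _]; last exact: scaler0.
rewrite [X in X + _ == w]big1 => [|j _]; last exact: scaler0.
by rewrite addr0 add0r -le -me !eqxx.
Qed.

Lemma Ck_pair {V W X : normedModType R} k (U : set V) (f : V -> W)
    (g : V -> X) : open U ->
  Ck k U f -> Ck k U g -> Ck k U (fun x => (f x, g x)).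
Proof.
move=> oU; elim: k f g => [|k IH] f g Cf Cg.
  by move=> x Ux; apply: cvg_pair; [exact: Cf|exact: Cg].
split=> [x Ux|v].
  by apply: differentiable_pair; [exact: Ck_diff Cf Ux|exact: Ck_diff Cg Ux].
apply: (Ck_ext oU _ (IH _ _ (Ck_derive v Cf) (Ck_derive v Cg))) => x Ux.
have [df dg] := (Ck_diff Cf Ux, Ck_diff Cg Ux).
rewrite [RHS](deriveE _ (differentiable_pair df dg)) (diff_pair df dg) /=.
by rewrite (deriveE _ df) (deriveE _ dg).
Qed.

End Ck_comp.

#[global] Hint Resolve finite_dimR finite_dim_rV : core.

Section smooth.
Context {R : realType}.

Definition smooth_at {V W : normedModType R} (x : V) (f : V -> W) : Prop :=
  exists U : set V, [/\ open U, U x & forall k, Ck k U f].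

Lemma smooth_atW {V W : normedModType R} (A : set V) (f : V -> W) :
  (forall x, A x -> smooth_at x f) -> smooth_on A f.
Proof. by move=> sf x /sf [U [oU Ux Cf]]; exists U, f. Qed.

Lemma smooth_at_near {V W : normedModType R} (x : V) (f g : V -> W) :
  {near x, f =1 g} -> smooth_at x f -> smooth_at x g.
Proof.
move=> /near_open[P [oP Px fg]] [U [oU Ux Cf]].
exists (U `&` P); split=> //; [exact: openI|move=> k].
apply: (@Ck_ext _ _ _ _ _ f) => //; first exact: openI.
  by move=> y [_ /fg].
by apply: Ck_sub (Cf k) => y [].
Qed.

Lemma smooth_on_open {V W : normedModType R} (A : set V) (f : V -> W) :
  open A -> smooth_on A f -> forall x, A x -> smooth_at x f.
Proof.
move=> oA sf x Ax; have [U [g [oU Ux Cg fg]]] := sf x Ax.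
apply: (@smooth_at_near _ _ _ g); last by exists U.
have oUA : open (U `&` A) by exact: openI.
by apply: (open_near oUA) => // y [Uy Ay]; rewrite fg.
Qed.

Lemma smooth_at_diff {V W : normedModType R} (x : V) (f : V -> W) :
  smooth_at x f -> differentiable f x.
Proof. by move=> [U [_ Ux /(_ 1%N) [df _]]]; exact: df. Qed.

Lemma smooth_at_cont {V W : normedModType R} (x : V) (f : V -> W) :
  smooth_at x f -> {for x, continuous f}.
Proof. by move=> [U [_ Ux /(_ 0%N)]]; apply. Qed.

Lemma smooth_at_cst {V W : normedModType R} (x : V) (a : W) :
  smooth_at x (fun=> a).
Proof. by exists setT; split=> //; [exact: openT|move=> k; exact: Ck_cst]. Qed.

Lemma smooth_at2 {V W X Y : normedModType R} (x : V) (f : V -> W)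
    (g : V -> X) (h : V -> Y) :
  (forall k U, open U -> Ck k U f -> Ck k U g -> Ck k U h) ->
  smooth_at x f -> smooth_at x g -> smooth_at x h.
Proof.
move=> H [U [oU Ux Cf]] [U' [oU' Ux' Cg]]; exists (U `&` U').
split=> //; [exact: openI|move=> k].
by apply: H; [exact: openI|apply: Ck_sub (Cf k)|apply: Ck_sub (Cg k)] => y [].
Qed.

Lemma smooth_atD {V W : normedModType R} (x : V) (f g : V -> W) :
  smooth_at x f -> smooth_at x g -> smooth_at x (fun y => f y + g y).
Proof. by apply: smooth_at2 => k U; exact: CkD. Qed.

Lemma smooth_atM {V : normedModType R} (x : V) (f g : V -> R) :
  smooth_at x f -> smooth_at x g -> smooth_at x (fun y => f y * g y).
Proof. by apply: smooth_at2 => k U; exact: CkM. Qed.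

Lemma smooth_atZ {V W : normedModType R} (x : V) (f : V -> R) (g : V -> W) :
  smooth_at x f -> smooth_at x g -> smooth_at x (fun y => f y *: g y).
Proof. by apply: smooth_at2 => k U; exact: CkZ. Qed.

Lemma smooth_at_pair {V W X : normedModType R} (x : V) (f : V -> W)
    (g : V -> X) :
  smooth_at x f -> smooth_at x g -> smooth_at x (fun y => (f y, g y)).
Proof. by apply: smooth_at2 => k U; exact: Ck_pair. Qed.

Lemma smooth_atN {V W : normedModType R} (x : V) (f : V -> W) :
  smooth_at x f -> smooth_at x (fun y => - f y).
Proof.
move=> sf; have := smooth_atZ (@smooth_at_cst V R x (- 1)) sf.
by under eq_fun do rewrite scaleN1r.
Qed.

Lemma smooth_atX {V : normedModType R} (x : V) (f : V -> R) n :
  smooth_at x f -> smooth_at x (fun y => f y ^+ n).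
Proof.
move=> sf; elim: n => [|n IH]; first exact: smooth_at_cst.
by under eq_fun do rewrite exprS; exact: smooth_atM.
Qed.

Lemma smooth_at_sum {V W : normedModType R} (x : V) n (F : 'I_n -> V -> W) :
  (forall i, smooth_at x (F i)) -> smooth_at x (fun y => \sum_i F i y).
Proof.
move=> sF; elim: (index_enum _) => [|i r IH].
  by under eq_fun do rewrite big_nil; exact: smooth_at_cst.
by under eq_fun do rewrite big_cons; exact: smooth_atD.
Qed.

Lemma smooth_at_open {V W : normedModType R} (x : V) (f : V -> W) (P : set W) :
  open P -> P (f x) -> smooth_at x f ->
  exists U, [/\ open U, U x, forall k, Ck k U f & forall y, U y -> P (f y)].
Proof.
move=> oP Px sf; have := smooth_at_cont sf.
have [U [oU Ux Cf]] := sf.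
move=> /(_ P (open_nbhs_nbhs (conj oP Px))) /near_open[Q [oQ Qx QP]]; exists (U `&` Q).
split=> //; [exact: openI|move=> k|by move=> y [_ /QP]].
by apply: Ck_sub (Cf k) => y [].
Qed.

Lemma smooth_atV {V : normedModType R} (x : V) (f : V -> R) :
  f x != 0 -> smooth_at x f -> smooth_at x (fun y => (f y)^-1).
Proof.
move=> fx sf.
have oP : open [set r : R | r != 0] by exact: open_neq.
have [U [oU Ux Cf UP]] := smooth_at_open oP fx sf.
by exists U; split=> // k; apply: CkV.
Qed.

Lemma smooth_at_sqrt {V : normedModType R} (x : V) (f : V -> R) :
  0 < f x -> smooth_at x f -> smooth_at x (fun y => Num.sqrt (f y)).
Proof.
move=> fx sf.
have oP : open [set r : R | 0 < r] by exact: open_gt.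
have [U [oU Ux Cf UP]] := smooth_at_open oP fx sf.
by exists U; split=> // k; apply: Ck_sqrt.
Qed.

Lemma smooth_at_lin {V W : normedModType R} (x : V) (l : {linear V -> W}) :
  continuous l -> smooth_at x l.
Proof.
by move=> cl; exists setT; split=> //; [exact: openT|move=> k; exact: Ck_lin].
Qed.

Lemma smooth_at_comp {V W X : normedModType R} (x : V) (f : V -> W)
    (g : W -> X) : finite_dim W -> smooth_at x f -> smooth_at (f x) g ->
  smooth_at x (fun y => g (f y)).
Proof.
move=> fW sf [U' [oU' Ux' Cg]].
have [U [oU Ux Cf UP]] := smooth_at_open oU' Ux' sf.
by exists U; split=> // k; apply: (@Ck_comp _ _ _ _ _ _ U').
Qed.

Lemma smooth_at_id {V : normedModType R} (x : V) : smooth_at x id.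
Proof. by apply: (@smooth_at_lin _ _ x idfun) => y; exact: cvg_id. Qed.

Lemma smooth_at_fst {V W : normedModType R} (x : V * W) : smooth_at x fst.
Proof.
have lf : linear (fst : V * W -> V) by [].
pose l : {linear (V * W)%type -> V} := HB.pack fst (GRing.isLinear.Build _ _ _ _ _ lf).
by apply: (@smooth_at_lin _ _ x l) => y; exact: cvg_fst.
Qed.

Lemma smooth_at_snd {V W : normedModType R} (x : V * W) : smooth_at x snd.
Proof.
have lf : linear (snd : V * W -> W) by [].
pose l : {linear (V * W)%type -> W} := HB.pack snd (GRing.isLinear.Build _ _ _ _ _ lf).
by apply: (@smooth_at_lin _ _ x l) => y; exact: cvg_snd.
Qed.

Lemma smooth_at_coord {n} (x : 'rV[R]_n) j :
  smooth_at x (fun w : 'rV[R]_n => w ord0 j).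
Proof.
have lf : linear (fun w : 'rV[R]_n => w ord0 j) by move=> a u v; rewrite !mxE.
pose l : {linear 'rV[R]_n -> R} :=
  HB.pack (fun w : 'rV[R]_n => w ord0 j) (GRing.isLinear.Build _ _ _ _ _ lf).
by apply: (@smooth_at_lin _ _ x l) => y; exact: coord_continuous.
Qed.

Lemma smooth_at_rV {V : normedModType R} {n} (x : V) (f : V -> 'rV[R]_n) :
  (forall j, smooth_at x (fun y => f y ord0 j)) -> smooth_at x f.
Proof.
move=> sf; have -> : f = fun y => \sum_j f y ord0 j *: delta_mx ord0 j.
  by apply/funext => y; exact: row_sum_delta.
apply: smooth_at_sum => j; apply: smooth_atZ => //; exact: smooth_at_cst.
Qed.

End smooth.

(** * Smooth maps on subsets, diffeomorphisms and submanifolds *)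

Section smooth_on.
Context {R : realType}.

Lemma smooth_on_sub {V W : normedModType R} (A B : set V) (f : V -> W) :
  A `<=` B -> smooth_on B f -> smooth_on A f.
Proof.
move=> AB sf x /AB /sf [U [g [oU Ux Cg fg]]]; exists U, g.
by split=> // y /AB; exact: fg.
Qed.

Lemma smooth_onP {V W : normedModType R} (A : set V) (f : V -> W) :
  smooth_on A f <-> forall x, A x -> exists g, smooth_at x g /\
    \forall y \near x, A y -> f y = g y.
Proof.
split=> sf x /sf.
  move=> [U [g [oU Ux Cg fg]]]; exists g; split; first by exists U.
  by apply: (open_near oU) => // y Uy Ay; exact: fg.
move=> [g [[U [oU Ux Cg]] /near_open[ O [oO Ox fg]]]].
exists (U `&` O), g; split=> //; [exact: openI|move=> k|by move=> y Ay [Uy /fg]; exact].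
by apply: Ck_sub (Cg k) => y [].
Qed.

Lemma smooth_on_comp {V W X : normedModType R} (A : set V) (B : set W)
    (f : V -> W) (g : W -> X) : finite_dim W ->
  smooth_on A f -> (forall x, A x -> B (f x)) -> smooth_on B g ->
  smooth_on A (fun x => g (f x)).
Proof.
move=> fW /smooth_onP sf AB /smooth_onP sg; apply/smooth_onP => x Ax.
have [f' [sf' ff']] := sf x Ax; have [g' [sg' gg']] := sg _ (AB x Ax).
have fxE : f x = f' x by apply: (nbhs_singleton ff').
exists (fun y => g' (f' y)); split.
  by apply: smooth_at_comp => //; rewrite -fxE.
have cf := smooth_at_cont sf'; rewrite fxE in gg'.
have H : \forall y \near x, B (f' y) -> g (f' y) = g' (f' y) := cf _ gg'.
near=> y => Ay.
have ffy : f y = f' y by move: Ay; near: y.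
rewrite ffy; have : B (f' y) by rewrite -ffy; exact: AB.
by near: y.
Unshelve. all: by end_near. Qed.

Lemma smooth_on_pair {V W X : normedModType R} (A : set V)
    (f : V -> W) (g : V -> X) :
  smooth_on A f -> smooth_on A g -> smooth_on A (fun x => (f x, g x)).
Proof.
move=> /smooth_onP sf /smooth_onP sg; apply/smooth_onP => x Ax.
have [f' [sf' ff']] := sf x Ax; have [g' [sg' gg']] := sg x Ax.
exists (fun y => (f' y, g' y)); split; first exact: smooth_at_pair.
by near=> y => Ay; congr (_, _); move: Ay; near: y.
Unshelve. all: by end_near. Qed.

Lemma smooth_on_continuous {V W : normedModType R} (A : set V) (f : V -> W) :
  smooth_on A f -> {within A, continuous f}.
Proof.
move=> /smooth_onP sf; apply/subspace_continuousP => x Ax.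
have [g [sg fg]] := sf x Ax; have fxE : f x = g x by exact: (nbhs_singleton fg Ax).
suff H : f @ within A (nbhs x) --> g x by rewrite -fxE in H; exact: H.
apply: (@cvg_trans _ (g @ within A (nbhs x))).
  apply: near_eq_cvg; rewrite near_withinE.
  by near=> y => Ay; apply/esym; move: Ay; near: y.
apply: cvg_within_filter; exact: smooth_at_cont.
Unshelve. all: by end_near. Qed.

End smooth_on.

Section diffeomorphism.
Context {R : realType}.

(** On a compact set injectivity already makes the inverse continuous: the
    image of the part of [S] outside a neighbourhood of [q] is closed and
    misses [f q].  So smooth left inverses that are only right near each point
    of [S] glue to a smooth inverse on the whole image. *)
Lemma diffeomorphism_compact {V W : normedModType R} (S : set V) (f : V -> W) :
  compact S -> smooth_on S f ->
  (forall p q, S p -> S q -> f p = f q -> p = q) ->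
  (forall p, S p -> exists (O : set V) (g : W -> V),
     [/\ open O, O p, smooth_at (f p) g &
         forall q, S q -> O q -> g (f q) = q]) ->
  diffeomorphism S (f @` S) f.
Proof.
move=> cS sf fI loc; split=> //.
pose g y : V := xget 0 [set q | S q /\ f q = y].
have gK q : S q -> g (f q) = q.
  move=> Sq; have [|Sg fg] := @xgetPex _ 0 [set p | S p /\ f p = f q].
    by exists q.
  exact: fI.
exists g; split=> // _ [q Sq <-].
have [ O [h [oO Oq [U [oU Uq Ch]] hK]]] := loc q Sq.
pose K := S `&` ~` O.
have cK : compact K by apply: compact_closedI => //; exact: open_closedC.
have cfK : closed (f @` K).
  apply: compact_closed; first exact: norm_hausdorff.
  apply: continuous_compact => //; apply: smooth_on_continuous.
  by apply: smooth_on_sub sf => x [].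
exists (U `&` ~` (f @` K)), h; split.
- by apply: openI => //; exact: closed_openC.
- by split=> // -[p [Sp nOp] /fI]; move=> /(_ Sp Sq) pq; apply: nOp; rewrite pq.
- by move=> k; apply: Ck_sub (Ch k) => y [].
- move=> _ [p Sp <-] [_ nK]; rewrite gK// hK//.
  by apply: contrapT => nOp; apply: nK; exists p.
Qed.

Lemma submanifold_diffeomorphism {V W : normedModType R} m (S : set V)
    (M : set W) (f : V -> W) : finite_dim V -> finite_dim W ->
  submanifold m S -> diffeomorphism S M f -> submanifold m M.
Proof.
move=> fV fW mS [sf <- [g [sg gK]]] _ [q Sq <-].
have [ O [U [phi [oO Oq oU [sphi phiE [psi [spsi psiK]]]]]]] := mS q Sq.
pose P := [set y | (f @` S) y -> O (g y)].
have PS p : S p -> O p -> P^° (f p).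
  move=> Sp Op; have [g' [sg' gg']] := (smooth_onP _ _).1 sg (f p) (ex_intro2 _ _ _ Sp erefl).
  have gpE := nbhs_singleton gg' (ex_intro2 _ _ _ Sp erefl).
  have H : \forall y \near f p, O (g' y).
    apply: (smooth_at_cont sg'); rewrite -gpE gK//.
    exact: open_nbhs_nbhs.
  near=> y => Sy; have -> : g y = g' y by move: Sy; near: y.
  by near: y.
have SU u : U u -> (S `&` O) (phi u) by move=> Uu; rewrite -phiE; exists u.
exists P^°, U, (fun u => f (phi u)); split=> //.
- exact: open_interior.
- exact: PS.
split.
- by apply: smooth_on_comp sphi _ sf => // u /SU[].
- rewrite eqEsubset; split=> [_ [u /SU [Su Ou] <-]|_ [[p Sp <-] /interior_subset]].
    by split; [exists (phi u)|exact: PS].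
  move=> /(_ (ex_intro2 _ _ _ Sp erefl)); rewrite gK// => Op.
  by have [u Uu <-] : (phi @` U) p; [rewrite phiE|exists u].
- exists (fun y => psi (g y)); split=> [|u Uu]; last first.
    by have [Su _] := SU u Uu; rewrite gK ?psiK.
  apply: smooth_on_comp spsi => //; first by apply: smooth_on_sub sg => y [].
  by move=> _ [[p Sp <-] /interior_subset /(_ (ex_intro2 _ _ _ Sp erefl))]; rewrite gK.
Unshelve. all: by end_near. Qed.

Lemma submanifoldX {V W : normedModType R} m n (A : set V) (B : set W) :
  finite_dim V -> finite_dim W ->
  submanifold m A -> submanifold n B -> submanifold (m + n) (A `*` B).
Proof.
move=> fV fW mA mB [a b] [/= Aa Bb].
have [ O [U [f [oO Oa oU [sf fE [f' [sf' fK]]]]]]] := mA a Aa.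
have [P [X [g [oP Pb oX [sg gE [g' [sg' gK]]]]]]] := mB b Bb.
have sl (w : 'rV[R]_(m + n)) : smooth_at w lsubmx.
  apply: smooth_at_rV => j; have -> : (fun y : 'rV[R]_(m + n) => lsubmx y ord0 j)
    = fun y => y ord0 (lshift n j) by apply/funext => y; rewrite mxE.
  exact: smooth_at_coord.
have sr (w : 'rV[R]_(m + n)) : smooth_at w rsubmx.
  apply: smooth_at_rV => j; have -> : (fun y : 'rV[R]_(m + n) => rsubmx y ord0 j)
    = fun y => y ord0 (rshift m j) by apply/funext => y; rewrite mxE.
  exact: smooth_at_coord.
exists (O `*` P), [set w | U (lsubmx w) /\ X (rsubmx w)],
  (fun w => (f (lsubmx w), g (rsubmx w))).
have fAO u : U u -> (A `&` O) (f u) by move=> Uu; rewrite -fE; exists u.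
have gBP u : X u -> (B `&` P) (g u) by move=> Uu; rewrite -gE; exists u.
split=> //.
- apply: (@openI _ (fst @^-1` O) (snd @^-1` P)); apply: open_comp => // w _.
    exact: smooth_at_cont (smooth_at_fst w).
  exact: smooth_at_cont (smooth_at_snd w).
- apply: (@openI _ (lsubmx @^-1` U) (rsubmx @^-1` X)); apply: open_comp => // w _.
    exact: smooth_at_cont.
  exact: smooth_at_cont.
split.
- apply: smooth_on_pair.
    apply: (smooth_on_comp (finite_dim_rV m) _ _ sf); last by move=> w [].
    by apply: smooth_atW => w _; exact: sl.
  apply: (smooth_on_comp (finite_dim_rV n) _ _ sg); last by move=> w [].
  by apply: smooth_atW => w _; exact: sr.
- rewrite eqEsubset; split=> [_ [w [/fAO[? ?] /gBP[? ?]] <-]//|[x y] /= [[Ax By] [Ox Py]]].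
  have [u Uu <-] : (f @` U) x by rewrite fE.
  have [v Xv <-] : (g @` X) y by rewrite gE.
  by exists (row_mx u v); rewrite /= row_mxKl row_mxKr.
- exists (fun p => row_mx (f' p.1) (g' p.2)); split; last first.
    by move=> w [Uw Xw] /=; rewrite fK ?gK ?hsubmxK.
  have sf1 : smooth_on ((A `*` B) `&` (O `*` P)) (fun p => f' p.1).
    apply: (smooth_on_comp _ _ _ sf') => //; last by move=> p [[? ?] [? ?]].
    by apply: smooth_atW => p _; exact: smooth_at_fst.
  have sg1 : smooth_on ((A `*` B) `&` (O `*` P)) (fun p => g' p.2).
    apply: (smooth_on_comp _ _ _ sg') => //; last by move=> p [[? ?] [? ?]].
    by apply: smooth_atW => p _; exact: smooth_at_snd.
  apply: (@smooth_on_comp _ _ _ _ _ setT (fun p => (f' p.1, g' p.2))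
    (fun q => row_mx q.1 q.2) _ (smooth_on_pair sf1 sg1)) => //.
    exact: finite_dimX (finite_dim_rV m) (finite_dim_rV n).
  apply: smooth_atW => q _; apply: smooth_at_rV => j.
  under eq_fun do rewrite mxE; case: (fintype.split j) => i.
    exact: (smooth_at_comp (finite_dim_rV _) (smooth_at_fst q) (smooth_at_coord _ i)).
  exact: (smooth_at_comp (finite_dim_rV _) (smooth_at_snd q) (smooth_at_coord _ i)).
Qed.

End diffeomorphism.

(** * A flat function *)

Section flat.
Context {R : realType}.

(** The functions [t ^- n * exp (- 1 / t)], extended by [0] to [t <= 0].  The
    powers of [1 / t] make the family stable under differentiation, so that all
    its members are smooth by one induction on the order. *)
Definition flat (n : nat) (t : R) : R :=
  if 0 < t then (t^-1) ^+ n * expR (- t^-1) else 0.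

Lemma exprn_le_expR n (x : R) : 0 <= x -> x ^+ n.+1 <= n.+1%:R ^+ n.+1 * expR x.
Proof.
move=> x0; have n0 : 0 < n.+1%:R :> R by rewrite ltr0n.
have -> : expR x = expR (x / n.+1%:R) ^+ n.+1.
  by rewrite -expRM_natl mulrC divfK// gt_eqF.
have xn : x <= n.+1%:R * expR (x / n.+1%:R).
  rewrite -ler_pdivrMl//; apply: le_trans (expR_ge1Dx _).
  by rewrite mulrC lerDr.
by rewrite -exprMn; apply: lerXn2r; rewrite // nnegrE // (le_trans x0).
Qed.

Lemma flat_le0 n (t : R) : t <= 0 -> flat n t = 0.
Proof. by move=> t0; rewrite /flat ifF//; apply/negbTE; rewrite -leNgt. Qed.

(** Vanishing to second order at [0] is what makes the difference quotients
    there tend to [0]. *)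
Lemma flat_bound n (t : R) : `|flat n t| <= n.+2%:R ^+ n.+2 * `|t| ^+ 2.
Proof.
rewrite /flat; case: ifPn => t0; last first.
  by rewrite normr0 mulr_ge0 ?exprn_ge0.
have ti : 0 < t^-1 by rewrite invr_gt0.
have ti0 := ltW ti.
rewrite ger0_norm ?mulr_ge0 ?exprn_ge0 ?expR_ge0//.
rewrite (ger0_norm (ltW t0)).
have H := @exprn_le_expR n.+1 (t^-1) (ltW ti).
rewrite expRN ler_pdivrMr ?expR_gt0// mulrAC.
have -> : t^-1 ^+ n = t^-1 ^+ n.+2 * t ^+ 2.
  by rewrite -[in RHS]addn2 exprD -mulrA -exprMn mulVf ?gt_eqF// expr1n mulr1.
by rewrite ler_pM2r ?exprn_gt0.
Qed.

Lemma is_derive_flat n (t : R) :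
  is_derive t 1 (flat n) (flat n.+2 t - n%:R * flat n.+1 t).
Proof.
have [t0|t0|->] := ltgtP t 0.
- apply: (@near_eq_is_derive _ _ _ (fun=> 0)).
    near=> s; rewrite flat_le0// ltW//.
    by near: s; exact: lt_nbhsl.
  have e m : flat m t = 0 by rewrite flat_le0// ltW.
  by rewrite !e mulr0 subr0; exact: is_derive_cst.
- apply: (@near_eq_is_derive _ _ _ (fun s : R => (s^-1) ^+ n * expR (- s^-1))).
    near=> s; rewrite /flat ifT//.
    by near: s; exact: lt_nbhsr.
  have dV : is_derive t 1 (fun s : R => s^-1) (- t ^- 2).
    have := @is_deriveV R id t 1 1; rewrite /= gt_eqF// => /(_ isT) H.
    by move: H; rewrite [_ *: _]mulr1; apply; exact: is_derive_id.
  have dX := is_deriveX n dV.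
  have dN := is_deriveN dV.
  have dE := @is_derive1_comp R expR _ t _ _ (is_derive_expR _) dN.
  have dF := is_deriveM dX dE.
  have fE : (fun s : R => s^-1 ^+ n * expR (- s^-1)) =
    (fun s : R => s^-1) ^+ n * (expR \o - (fun s : R => s^-1)).
    by apply/funext => s; rewrite mulrfctE exprfctE.
  rewrite fE; apply: (is_derive_eq dF); rewrite exprfctE.
  rewrite /flat t0 /= !fctE /= /GRing.scale /=.
  case: n {dX dF fE} => [|n]; first by rewrite !mul0r subr0 mulr0 addr0 -!exprVn expr0; ring.
  by rewrite /= -!exprVn !exprS; ring.
- have F0 : flat n 0 = 0 by rewrite /flat ltxx.
  have H : h^-1 *: ((flat n \o shift 0) (h *: 1) - flat n 0) @[h --> 0^'] --> (0 : R).
    pose C : R := n.+2%:R ^+ n.+2.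
    have C0 : 0 < C by rewrite exprn_gt0// ltr0n.
    apply/cvgrPdist_le => e e0; near=> h.
    have h0 : h != 0 by near: h; exact: nbhs_dnbhs_neq.
    rewrite F0 subr0 sub0r normrN /= addr0 [h *: 1]mulr1 normrZ normfV.
    rewrite ler_pdivrMl ?normr_gt0//; apply: le_trans (flat_bound n h) _.
    rewrite expr2 mulrCA ler_pM2l ?normr_gt0// -/C -ler_pdivlMl// mulrC.
    near: h; apply: dnbhs0_le; exact: divr_gt0.
  have -> : flat n.+2 0 - n%:R * flat n.+1 0 = 0 :> R.
    by rewrite !flat_le0// mulr0 subr0.
  by apply: DeriveDef; [apply/cvg_ex; exists 0|exact: cvg_lim H].
Unshelve. all: by end_near. Qed.

Lemma Ck_flat k n (U : set R) : open U -> Ck k U (flat n).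
Proof.
move=> oU; elim: k n => [|k IH] n.
  move=> x _; apply: differentiable_continuous; apply/derivable1_diffP.
  by have [] := is_derive_flat n x.
have df x : differentiable (flat n) x.
  by apply/derivable1_diffP; have [] := is_derive_flat n x.
split=> // v.
apply: (@Ck_ext _ _ _ _ _ (fun x => v * (flat n.+2 x - n%:R * flat n.+1 x))) => //.
  move=> x _; have [_ <-] := is_derive_flat n x.
  by rewrite [RHS](deriveE _ (df x)) (diff1E (df x)) derive1E.
apply: CkM => //; first exact: Ck_cst.
apply: (@Ck_ext _ _ _ _ _ (fun x => flat n.+2 x + - n%:R * flat n.+1 x)) => //.
  by move=> x _; rewrite mulNr.
by apply: CkD => //; apply: CkM => //; exact: Ck_cst.
Qed.

Lemma smooth_at_flat n x : smooth_at x (flat n).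
Proof. by exists setT; split=> //; [exact: openT|move=> k; exact: Ck_flat openT]. Qed.

Lemma flat_ge0 (t : R) : 0 <= flat 0 t.
Proof. by rewrite /flat; case: ifP => // _; rewrite expr0 mul1r expR_ge0. Qed.

Lemma flat_le1 (t : R) : t <= 1 -> flat 0 t / flat 0 1 <= 1.
Proof.
move=> t1; rewrite ler_pdivrMr ?mul1r /flat ltr01 ?mulr_gt0 ?expR_gt0//.
case: ifPn => t0; last by rewrite mulr_ge0 ?expR_ge0.
by rewrite !expr0 !mul1r ler_expR lerN2 invr1 invf_ge1.
Qed.

Lemma flat1_neq0 : flat 0 1 != 0.
Proof. by rewrite gt_eqF// /flat ltr01 mulr_gt0 ?expR_gt0. Qed.

End flat.

(** * Legendrian isotopies from families of embeddings *)

Section isotopy.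
Context {R : realType}.

Lemma finite_dim_contact N : finite_dim (contact_space R N).
Proof. exact: finite_dimX (finite_dimX (finite_dim_rV N) (finite_dim_rV N)) finite_dimR. Qed.

Lemma diffeomorphism_comp {V W X : normedModType R} (A : set V) (B : set W)
    (C : set X) (f : V -> W) (g : W -> X) : finite_dim W ->
  diffeomorphism A B f -> diffeomorphism B C g ->
  diffeomorphism A C (fun x => g (f x)).
Proof.
move=> fW [sf fE [f' [sf' fK]]] [sg gE [g' [sg' gK]]].
have fB x : A x -> B (f x) by move=> Ax; rewrite -fE; exists x.
split.
- exact: smooth_on_comp sf fB sg.
- by rewrite -gE -fE -image_comp.
- exists (fun y => f' (g' y)); split; last by move=> x Ax; rewrite gK ?fK//; exact: fB.
  apply: (smooth_on_comp fW sg' _ sf') => z Cz.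
  by have [y By <-] : (g @` B) z; [rewrite gE|rewrite gK].
Qed.

Lemma diffeomorphism_inv {V W : normedModType R} (A : set V) (B : set W)
    (f : V -> W) : diffeomorphism A B f ->
  exists g, diffeomorphism B A g /\ forall x, A x -> g (f x) = x.
Proof.
move=> [sf <- [g [sg gK]]]; exists g; split=> //; split=> //.
  rewrite eqEsubset; split=> [_ [_ [x Ax <-] <-]|x Ax]; first by rewrite gK.
  by exists (f x); [exists x|rewrite gK].
by exists f; split=> // _ [x Ax <-]; rewrite gK.
Qed.

(** Curves stand for tangent vectors of [S], in accordance with the definition
    of [tangent]. *)
Definition pulls_back_to0 {V : normedModType R} {N} (S : set V)
    (f : V -> contact_space R N) : Prop :=
  forall (e : R) (delta : R -> V), 0 < e -> smooth_on `]- e, e[ delta ->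
    (forall t, - e < t < e -> S (delta t)) ->
    contact_form (f (delta 0)) ('D_1 (fun t => f (delta t)) 0) = 0.

(** A curve in [M] is the image of a curve in [S], by the smooth inverse of
    [f]; this moves the contact condition from [M] to [S]. *)
Lemma legendrian_diffeomorphism {V : normedModType R} {N} (S : set V)
    (M : set (contact_space R N)) (f : V -> contact_space R N) :
  finite_dim V -> submanifold N S -> diffeomorphism S M f ->
  pulls_back_to0 S f -> legendrian M.
Proof.
move=> fV mS df pf; split.
  exact: submanifold_diffeomorphism (finite_dim_contact N) mS df.
move=> p v Mp [e [gamma [e0 sg Mg gp gv]]].
have [sf fE [g [sG gK]]] := df.
have fgK y : M y -> f (g y) = y by rewrite -fE => -[x Sx <-]; rewrite gK.
have := pf e (fun t => g (gamma t)) e0; rewrite fgK ?gp//.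
have -> : 'D_1 (fun t => f (g (gamma t))) 0 = v.
  rewrite -gv; apply: near_eq_derive; near=> t; rewrite fgK//; apply: Mg.
  apply/andP; split; near: t; last exact: lt_nbhsl.
  by apply: lt_nbhsr; rewrite oppr_lt0.
apply.
  apply: (smooth_on_comp (finite_dim_contact N) sg _ sG) => t /=.
  by rewrite in_itv /=; exact: Mg.
by move=> t te; rewrite -fE in Mg; have [x Sx <-] := Mg t te; rewrite gK.
Unshelve. all: by end_near. Qed.

(** An isotopy has to be parametrized by its initial member; composing with the
    inverse of [Psi 0] does this, and then every condition can be checked in the
    fixed parameter space [S].  By [diffeomorphism_compact] local inverses,
    chosen for one [t] at a time, are enough. *)
Lemma isotopy_of_family {V : normedModType R} {N} (S : set V)
    (Psi : R -> V -> contact_space R N) : finite_dim V ->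
  compact S -> submanifold N S ->
  smooth_on [set tp : R * V | 0 <= tp.1 <= 1 /\ S tp.2]
    (fun tp => Psi tp.1 tp.2) ->
  (forall t, 0 <= t <= 1 -> forall p q, S p -> S q ->
     Psi t p = Psi t q -> p = q) ->
  (forall t, 0 <= t <= 1 -> forall p, S p ->
     exists (O : set V) (g : contact_space R N -> V),
     [/\ open O, O p, smooth_at (Psi t p) g &
         forall q, S q -> O q -> g (Psi t q) = q]) ->
  (forall t, 0 <= t <= 1 -> pulls_back_to0 S (Psi t)) ->
  legendrian_isotopic (Psi 0 @` S) (Psi 1 @` S).
Proof.
move=> fV cS mS sPsi inj loc pb.
have sPsit t : 0 <= t <= 1 -> smooth_on S (Psi t).
  move=> t01; apply: (@smooth_on_comp _ _ _ _ _ _ (fun p => (t, p)) _ _ _ _ sPsi).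
  - exact: finite_dimX finite_dimR fV.
  - by apply: smooth_atW => p _; exact: smooth_at_pair (smooth_at_cst _ _) (smooth_at_id _).
  - by move=> p Sp.
have dPsi t : 0 <= t <= 1 -> diffeomorphism S (Psi t @` S) (Psi t).
  move=> t01; apply: diffeomorphism_compact => //; first exact: sPsit.
    exact: inj.
  exact: loc.
have i0 : 0 <= (0 : R) <= 1 by lra.
have i1 : 0 <= (1 : R) <= 1 by lra.
have [g [dg gK]] := diffeomorphism_inv (dPsi 0 i0).
have [sg gE _] := dg.
have FE t : (fun p => Psi t (g p)) @` (Psi 0 @` S) = Psi t @` S.
  by rewrite -[in RHS]gE [RHS]image_comp.
exists (fun t p => Psi t (g p)); split.
- pose h (tp : R * contact_space R N) := (tp.1, g tp.2).
  apply: (@smooth_on_comp _ _ _ _ _ _ h _ _ _ _ sPsi).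
  + exact: finite_dimX finite_dimR fV.
  + apply: smooth_on_pair; first by apply: smooth_atW => tp _; exact: smooth_at_fst.
    apply: (smooth_on_comp (finite_dim_contact N) _ _ sg); last by move=> tp [].
    by apply: smooth_atW => tp _; exact: smooth_at_snd.
  + by move=> tp [t01 Mp]; split=> //=; rewrite -gE; exists tp.2.
- move=> t t01; rewrite FE; split.
    exact: legendrian_diffeomorphism (dPsi t t01) (pb t t01).
  exact: diffeomorphism_comp dg (dPsi t t01).
- by move=> _ [p Sp <-]; rewrite gK.
- exact: FE.
Qed.

(** The first isotopy is run with a clock that stops at [t = 1 / 3], the second
    with a clock that starts at [t = 1 / 2].  Both clocks are built from [flat],
    hence smooth, and in between nothing moves, so the two pieces agree on an
    open set of times. *)
Lemma legendrian_isotopic_trans {N} (A B C : set (contact_space R N)) :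
  legendrian_isotopic A B -> legendrian_isotopic B C -> legendrian_isotopic A C.
Proof.
move=> [F [sF dF F0 F1]] [G [sG dG G0 G1]].
pose phi t : R := 1 - flat 0 (1 - 3 * t) / flat 0 1.
pose psi t : R := flat 0 (2 * t - 1) / flat 0 1.
have sphi t : smooth_at t phi.
  apply: smooth_atD (smooth_at_cst _ _) (smooth_atN (smooth_atM _ (smooth_at_cst _ _))).
  apply: (@smooth_at_comp R R R R t (fun t : R => 1 - 3 * t) (flat 0) _ _ (smooth_at_flat _ _)) => //.
  apply: smooth_atD (smooth_at_cst _ _) (smooth_atN (smooth_atM (smooth_at_cst _ _) _)).
  exact: smooth_at_id.
have spsi t : smooth_at t psi.
  apply: smooth_atM _ (smooth_at_cst _ _).
  apply: (@smooth_at_comp R R R R t (fun t : R => 2 * t - 1) (flat 0) _ _ (smooth_at_flat _ _)) => //.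
  apply: smooth_atD (smooth_atM (smooth_at_cst _ _) _) (smooth_at_cst _ _).
  exact: smooth_at_id.
have f1 := @flat1_neq0 R.
have f1g : 0 < flat 0 1 :> R by rewrite lt_neqAle eq_sym f1 flat_ge0.
have phi01 t : 0 <= t <= 1 -> 0 <= phi t <= 1.
  move=> /andP[t0 t1]; rewrite /phi subr_ge0 flat_le1 ?gerBl ?divr_ge0 ?flat_ge0//.
  by lra.
have psi01 t : 0 <= t <= 1 -> 0 <= psi t <= 1.
  move=> /andP[t0 t1]; rewrite /psi flat_le1 ?divr_ge0 ?flat_ge0//.
  by lra.
have phi1 t : 1 / 3 <= t -> phi t = 1.
  by move=> t3; rewrite /phi flat_le0 ?mul0r ?subr0//; lra.
have psi0 t : t <= 1 / 2 -> psi t = 0.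
  by move=> t3; rewrite /psi flat_le0 ?mul0r//; lra.
have i1 : 0 <= (1 : R) <= 1 by lra.
have FB p : A p -> B (F 1 p) by move=> Ap; rewrite -F1; exists p.
exists (fun t p => if t < 1 / 2 then F (phi t) p else G (psi t) (F 1 p)); split.
- apply/smooth_onP => -[t p] [/= t01 Ap].
  have fRc := finite_dimX (@finite_dimR R) (finite_dim_contact N).
  have sF' : smooth_on [set tp : R * contact_space R N | 0 <= tp.1 <= 1 /\ A tp.2]
      (fun tp => F (phi tp.1) tp.2).
    pose h (tp : R * contact_space R N) := (phi tp.1, tp.2).
    apply: (@smooth_on_comp _ _ _ _ _ _ h _ fRc _ _ sF).
      apply: smooth_atW => tp _; apply: smooth_at_pair (smooth_at_snd _).
      exact: smooth_at_comp (smooth_at_fst _) (sphi _).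
    by move=> tp [tp01 Atp]; split=> //=; exact: phi01.
  have sF1 : smooth_on [set tp : R * contact_space R N | 0 <= tp.1 <= 1 /\ A tp.2]
      (fun tp => F 1 tp.2).
    pose h (tp : R * contact_space R N) := ((1 : R), tp.2).
    apply: (@smooth_on_comp _ _ _ _ _ _ h _ fRc _ _ sF).
      by apply: smooth_atW => tp _; apply: smooth_at_pair (smooth_at_cst _ _) (smooth_at_snd _).
    by move=> tp [tp01 Atp]; split.
  have sG' : smooth_on [set tp : R * contact_space R N | 0 <= tp.1 <= 1 /\ A tp.2]
      (fun tp => G (psi tp.1) (F 1 tp.2)).
    pose h (tp : R * contact_space R N) := (psi tp.1, F 1 tp.2).
    apply: (@smooth_on_comp _ _ _ _ _ _ h _ fRc _ _ sG).
      apply: smooth_on_pair sF1; apply: smooth_atW => tp _.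
      exact: smooth_at_comp (smooth_at_fst _) (spsi _).
    by move=> tp [tp01 Atp]; split=> /=; [exact: psi01|exact: FB].
  have cfst := @smooth_at_cont _ _ _ _ _ (@smooth_at_fst _ R (contact_space R N) (t, p)).
  have [t2|t2] := ltP t (1 / 2).
    have [h [sh Fh]] := (smooth_onP _ _).1 sF' (t, p) (conj t01 Ap).
    exists h; split=> //.
    have H : \forall y \near (t, p), y.1 < 1 / 2 := cfst _ (lt_nbhsl t2).
    near=> y => Ay; have y2 : y.1 < 1 / 2 by near: y.
    by rewrite y2; move: Ay; near: y.
  have [h [sh Gh]] := (smooth_onP _ _).1 sG' (t, p) (conj t01 Ap).
  exists h; split=> //.
  have t3 : 1 / 3 < t by apply: lt_le_trans t2; lra.
  have H : \forall y \near (t, p), 1 / 3 < y.1 := cfst _ (lt_nbhsr t3).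
  near=> y => -[y01 Ay]; have y3 : 1 / 3 < y.1 by near: y.
  have <- : G (psi y.1) (F 1 y.2) = h y by move: (conj y01 Ay); near: y.
  case: ifPn => // y2; rewrite (psi0 _ (ltW y2)) (phi1 _ (ltW y3)) G0//.
  exact: FB.
- move=> t t01; case: ltP => t2; first exact: dF (phi01 t t01).
  have [_ dF1] := dF 1 i1; rewrite F1 in dF1.
  have [lG dGt] := dG _ (psi01 t t01).
  have -> : (fun p => G (psi t) (F 1 p)) @` A = G (psi t) @` B.
    by rewrite -F1 -image_comp.
  split=> //; exact: diffeomorphism_comp (finite_dim_contact N) dF1 dGt.
- move=> p Ap; rewrite divr_gt0// /phi mulr0 subr0 divff// subrr; exact: F0.
- have -> : (1 : R) < 1 / 2 = false by apply/negbTE; rewrite -leNgt; lra.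
  have -> : psi 1 = 1 by rewrite /psi mulr1 (_ : 2 - 1 = 1) ?divff//; lra.
  by rewrite -G1 -F1 -image_comp.
Unshelve. all: by end_near. Qed.

End isotopy.

(** * The unit circle *)

Section circle.
Context {R : realType}.

Lemma unit_circle_cos_sin (p : R * R) : unit_circle p <->
  exists2 theta, 0 <= theta <= 2 * pi & p = (cos theta, sin theta).
Proof.
split=> [|[theta _ ->]]; last by rewrite /unit_circle /= cos2Dsin2.
case: p => x y; rewrite /unit_circle /= => xy1.
have x1 : -1 <= x <= 1 by apply/andP; split; nra.
have c : cos (acos x) = x by rewrite acosK// in_itv.
have s : sin (acos x) = `|y|.
  by rewrite sin_acos// -sqrtr_sqr; congr Num.sqrt; lra.
have a0 := acos_ge0 x1; have api := acos_lepi x1.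
have [y0|y0] := leP 0 y.
  exists (acos x); first by apply/andP; split=> //; lra.
  by rewrite c s ger0_norm.
exists (2 * pi - acos x); first by apply/andP; split; lra.
have -> : 2 * pi - acos x = - acos x + pi *+ 2 by ring.
by rewrite cosD2pi sinD2pi cosN sinN c s ltr0_norm// opprK.
Qed.

Lemma compact_unit_circle : compact (@unit_circle R).
Proof.
have cI : compact (`[(-1 : R), 1] `*` `[(-1 : R), 1]).
  by apply: compact_setX; exact: segment_compact.
apply: (subclosed_compact _ cI).
  pose f (p : R * R) := p.1 ^+ 2 + p.2 ^+ 2.
  have cf : continuous f.
    move=> p; apply: smooth_at_cont; apply: smooth_atD; apply: smooth_atX.
      exact: smooth_at_fst.
    exact: smooth_at_snd.
  have -> : unit_circle = f @^-1` [set 1] by [].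
  by apply: closed_comp => // p _; exact: cf.
by move=> [x y]; rewrite /unit_circle /= => xy1; split; rewrite /= in_itv /=;
  apply/andP; split; nra.
Qed.

(** Inverse stereographic projection from [(- e, 0)], for [e] a sign.  Being
    rational, it serves both as a chart and as a curve along which forms on the
    circle can be integrated. *)
Definition stereo (e s : R) : R * R :=
  (e * (1 - s ^+ 2) / (1 + s ^+ 2), 2 * s / (1 + s ^+ 2)).

Lemma stereo_denom (s : R) : 1 + s ^+ 2 != 0.
Proof. by rewrite gt_eqF//; nra. Qed.

Lemma smooth_at_stereo {V : normedModType R} e (x : V) (f : V -> R) :
  smooth_at x f -> smooth_at x (fun y => stereo e (f y)).
Proof.
move=> sf; have sd : smooth_at x (fun y => (1 + f y ^+ 2)^-1).
  apply: smooth_atV; first exact: stereo_denom.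
  exact: smooth_atD (smooth_at_cst _ _) (smooth_atX _ sf).
apply: smooth_at_pair; apply: smooth_atM sd; apply: smooth_atM (smooth_at_cst _ _) _ => //.
exact: smooth_atD (smooth_at_cst _ _) (smooth_atN (smooth_atX _ sf)).
Qed.

Lemma stereo_unit_circle e s : e * e = 1 -> unit_circle (stereo e s).
Proof.
move=> ee; rewrite /unit_circle /stereo /= !expr_div_n exprMn expr2 ee mul1r -mulrDl.
have -> : (1 - s ^+ 2) ^+ 2 + (2 * s) ^+ 2 = (1 + s ^+ 2) ^+ 2 by ring.
by rewrite divff// expf_neq0// stereo_denom.
Qed.

Lemma stereo_x e s : e * e = 1 -> 1 + e * (stereo e s).1 = 2 / (1 + s ^+ 2).
Proof.
by move=> ee; rewrite /stereo /= -mulrA mulrA ee; field; exact: stereo_denom.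
Qed.

Lemma stereoK e s : e * e = 1 -> (stereo e s).2 / (1 + e * (stereo e s).1) = s.
Proof. by move=> ee; rewrite stereo_x// /stereo /=; field; exact: stereo_denom. Qed.

Lemma stereo_surj e p : e * e = 1 -> unit_circle p -> 0 < 1 + e * p.1 ->
  stereo e (p.2 / (1 + e * p.1)) = p.
Proof.
case: p => x y ee; rewrite /unit_circle /= => xy1 xy0; rewrite /stereo.
have xn : 1 + e * x != 0 by rewrite gt_eqF.
have yE : y ^+ 2 = (1 - e * x) * (1 + e * x).
  have -> : y ^+ 2 = 1 - x ^+ 2 by lra.
  have -> : (1 - e * x) * (1 + e * x) = 1 - (e * e) * x ^+ 2 by ring.
  by rewrite ee mul1r.
have tE : (y / (1 + e * x)) ^+ 2 = (1 - e * x) / (1 + e * x).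
  by rewrite expr_div_n yE; field.
have sE : 1 + (1 - e * x) / (1 + e * x) = 2 / (1 + e * x) by field.
have rE : 1 - (1 - e * x) / (1 + e * x) = 2 * (e * x) / (1 + e * x) by field.
rewrite tE sE rE; congr (_, _); last by field.
have -> : e * (2 * (e * x) / (1 + e * x)) / (2 / (1 + e * x)) = e * e * x by field.
by rewrite ee mul1r.
Qed.

Lemma stereo_cover p : unit_circle p ->
  exists e s, [/\ e * e = 1, 0 < 1 + e * p.1 & p = stereo e s].
Proof.
move=> Cp; suff [e [ee ep]] : exists e, e * e = 1 /\ 0 < 1 + e * p.1.
  by exists e, (p.2 / (1 + e * p.1)); rewrite stereo_surj.
have [p1|p1] := leP 0 p.1; [exists 1|exists (- 1)]; split; rewrite ?mulr1 ?mulrNN ?mulr1//; lra.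
Qed.

Lemma submanifold_unit_circle : submanifold 1 (@unit_circle R).
Proof.
move=> p Cp; have [e [_ [ee ep _]]] := stereo_cover Cp.
pose phi (t : 'rV[R]_1) := stereo e (t ord0 ord0).
pose psi (q : R * R) : 'rV[R]_1 := \row__ (q.2 / (1 + e * q.1)).
have se q : smooth_at q (fun q : R * R => 1 + e * q.1).
  exact: smooth_atD (smooth_at_cst _ _) (smooth_atM (smooth_at_cst _ _) (smooth_at_fst _)).
exists [set q : R * R | 0 < 1 + e * q.1], setT, phi.
split=> //; [|exact: openT|split].
- apply: (@open_comp _ _ (fun q : R * R => 1 + e * q.1) [set r | 0 < r]).
    by move=> q _; exact: smooth_at_cont (se q).
  exact: open_gt.
- by apply: smooth_atW => t _; apply: smooth_at_stereo; exact: smooth_at_coord.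
- rewrite eqEsubset; split=> [_ [t _ <-]|q [Cq q0]].
    split; first exact: stereo_unit_circle.
    rewrite /= stereo_x// divr_gt0//.
    by apply: lt_le_trans ltr01 _; rewrite lerDl sqr_ge0.
  by exists (psi q) => //; rewrite /phi /psi mxE stereo_surj.
- exists psi; split=> [|t _].
    apply: smooth_atW => q [_ qO]; apply: smooth_at_rV => j.
    under eq_fun do rewrite mxE; apply: smooth_atM (smooth_at_snd _) _.
    by apply: smooth_atV => //; rewrite gt_eqF.
  by apply/rowP => j; rewrite (ord1 j) mxE stereoK.
Qed.

End circle.

(** * Derivatives along curves and the contact form of a suspension *)

Section derivative_rules.
Context {R : realType}.
Implicit Types (f g : R -> R) (x df dg : R).

Lemma is_derive_const x (a : R) : is_derive x 1 (fun=> a) 0.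
Proof. exact: is_derive_cst. Qed.

Lemma is_derive_add f g x df dg : is_derive x 1 f df -> is_derive x 1 g dg ->
  is_derive x 1 (fun y => f y + g y) (df + dg).
Proof. by move=> hf hg; exact: is_deriveD. Qed.

Lemma is_derive_opp f x df : is_derive x 1 f df -> is_derive x 1 (fun y => - f y) (- df).
Proof. by move=> hf; exact: is_deriveN. Qed.

Lemma is_derive_mul f g x df dg : is_derive x 1 f df -> is_derive x 1 g dg ->
  is_derive x 1 (fun y => f y * g y) (f x * dg + g x * df).
Proof. by move=> hf hg; exact: is_deriveM. Qed.

Lemma is_derive_exp f n x df : is_derive x 1 f df ->
  is_derive x 1 (fun y => f y ^+ n) (n%:R * f x ^+ n.-1 * df).
Proof.
move=> hf; have -> : (fun y => f y ^+ n) = f ^+ n by rewrite exprfctE.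
exact: is_deriveX.
Qed.

Lemma is_derive_inv f x df : f x != 0 -> is_derive x 1 f df ->
  is_derive x 1 (fun y => (f y)^-1) (- (f x) ^- 2 * df).
Proof. by move=> f0 hf; exact: is_deriveV. Qed.

Lemma derive_is f x df : is_derive x 1 f df -> 'D_1 f x = df.
Proof. by move=> hf; exact: derive_val. Qed.

End derivative_rules.

(** Compute the derivative at a point of an explicit rational expression in
    functions whose derivatives are in the context. *)
Ltac differentiate :=
  lazymatch goal with
  | |- is_derive ?x _ (fun y => @?f y + @?g y) _ => apply: (@is_derive_add _ f g x); differentiate
  | |- is_derive ?x _ (fun y => - @?f y) _ => apply: (@is_derive_opp _ f x); differentiate
  | |- is_derive ?x _ (fun y => @?f y * @?g y) _ => apply: (@is_derive_mul _ f g x); differentiate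
  | |- is_derive ?x _ (fun y => @?f y ^+ ?n) _ => apply: (@is_derive_exp _ f n x); differentiate
  | |- is_derive ?x _ (fun y => (@?f y)^-1) _ => apply: (@is_derive_inv _ f x); [|differentiate]
  | |- _ => first [eassumption | apply: is_derive_const]
  end.

(** Smoothness of an explicit rational expression in functions whose
    smoothness is in the context; denominators are left as subgoals. *)
Ltac smooth :=
  lazymatch goal with
  | |- smooth_at ?x (fun y => (@?f y, @?g y)) =>
      apply: (@smooth_at_pair _ _ _ _ x f g); smooth
  | |- smooth_at ?x (fun y => @?f y + @?g y) =>
      apply: (@smooth_atD _ _ _ x f g); smooth
  | |- smooth_at ?x (fun y => - @?f y) => apply: (@smooth_atN _ _ _ x f); smooth
  | |- smooth_at ?x (fun y => @?f y * @?g y) =>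
      apply: (@smooth_atM _ _ x f g); smooth
  | |- smooth_at ?x (fun y => @?f y ^+ ?n) =>
      apply: (@smooth_atX _ _ x f n); smooth
  | |- smooth_at ?x (fun y => (@?f y)^-1) =>
      apply: (@smooth_atV _ _ x f); [|smooth]
  | |- smooth_at ?x (fun y => Num.sqrt (@?f y)) =>
      apply: (@smooth_at_sqrt _ _ x f); [|smooth]
  | |- _ => first [eassumption | apply: smooth_at_cst]
  end.

Section curves.
Context {R : realType}.

Lemma derive_comp_diff {V W X : normedModType R} (f : V -> W) (g : W -> X) x v :
  differentiable f x -> differentiable g (f x) ->
  'D_v (fun y => g (f y)) x = 'd g (f x) ('D_v f x).
Proof.
move=> df dg; rewrite (deriveE _ df).
by rewrite (deriveE _ (differentiable_comp df dg)) (diff_comp df dg).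
Qed.

Lemma derive_fst {V W X : normedModType R} (f : V -> W * X) x v :
  differentiable f x -> 'D_v (fun y => (f y).1) x = ('D_v f x).1.
Proof.
move=> df; have lf : linear (fst : W * X -> W) by [].
pose l : {linear (W * X)%type -> W} :=
  HB.pack (fst : W * X -> W) (GRing.isLinear.Build _ _ _ _ _ lf).
have cl : continuous l by move=> y; exact: cvg_fst.
have dl : differentiable l (f x) by exact: linear_differentiable.
by rewrite (derive_comp_diff _ df dl) (diff_lin _ cl).
Qed.

Lemma derive_snd {V W X : normedModType R} (f : V -> W * X) x v :
  differentiable f x -> 'D_v (fun y => (f y).2) x = ('D_v f x).2.
Proof.
move=> df; have lf : linear (snd : W * X -> X) by [].
pose l : {linear (W * X)%type -> X} :=
  HB.pack (snd : W * X -> X) (GRing.isLinear.Build _ _ _ _ _ lf).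
have cl : continuous l by move=> y; exact: cvg_snd.
have dl : differentiable l (f x) by exact: linear_differentiable.
by rewrite (derive_comp_diff _ df dl) (diff_lin _ cl).
Qed.

Lemma derive_coord {V : normedModType R} n (f : V -> 'rV[R]_n) x v j :
  differentiable f x -> 'D_v (fun y => f y ord0 j) x = 'D_v f x ord0 j.
Proof.
move=> df; have lf : linear (fun w : 'rV[R]_n => w ord0 j) by move=> a u w; rewrite !mxE.
pose l : {linear 'rV[R]_n -> R} :=
  HB.pack (fun w : 'rV[R]_n => w ord0 j) (GRing.isLinear.Build _ _ _ _ _ lf).
have cl : continuous l by move=> y; exact: coord_continuous.
have dl : differentiable l (f x) by exact: linear_differentiable.
by rewrite (derive_comp_diff _ df dl) (diff_lin _ cl).
Qed.

Lemma differentiable_coordinates {V : normedModType R} N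
    (f : V -> contact_space R N) x : differentiable f x ->
  [/\ forall j, differentiable (fun y => (f y).1.1 ord0 j) x,
      forall j, differentiable (fun y => (f y).1.2 ord0 j) x &
      differentiable (fun y => (f y).2) x].
Proof.
move=> df.
have d1 := differentiable_comp df (smooth_at_diff (smooth_at_fst (f x))).
have d2 := differentiable_comp df (smooth_at_diff (smooth_at_snd (f x))).
have d11 := differentiable_comp d1 (smooth_at_diff (smooth_at_fst (f x).1)).
have d12 := differentiable_comp d1 (smooth_at_diff (smooth_at_snd (f x).1)).
split=> // j.
  exact: (differentiable_comp d11 (smooth_at_diff (smooth_at_coord (f x).1.1 j))).
exact: (differentiable_comp d12 (smooth_at_diff (smooth_at_coord (f x).1.2 j))).
Qed.

Lemma contact_form_derive N (f : R -> contact_space R N) q t :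
  differentiable f t -> contact_form q ('D_1 f t) =
  'D_1 (fun s => (f s).2) t
  - \sum_(i < N) q.1.2 ord0 i * 'D_1 (fun s => (f s).1.1 ord0 i) t.
Proof.
move=> df; rewrite /contact_form (derive_snd _ df); congr (_ - _).
have d1 := differentiable_comp df (smooth_at_diff (smooth_at_fst (f t))).
have d11 := differentiable_comp d1 (smooth_at_diff (smooth_at_fst (f t).1)).
apply: eq_bigr => i _; congr (_ * _).
have -> := @derive_coord _ _ (fun y => (f y).1.1) t 1 i d11.
have -> := @derive_fst _ _ _ (fun y => (f y).1) t 1 d1.
by have -> := derive_fst (1 : R) df.
Qed.

Lemma unit_circle_derive (p1 p2 : R -> R) (dp1 dp2 : R) :
  is_derive (0 : R) (1 : R) p1 dp1 -> is_derive (0 : R) (1 : R) p2 dp2 ->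
  (\forall t \near 0, unit_circle (p1 t, p2 t)) ->
  p1 0 * dp1 + p2 0 * dp2 = 0.
Proof.
move=> h1 h2 C.
have [d [hd dE]] : exists d, is_derive (0 : R) (1 : R)
    (fun t => p1 t ^+ 2 + p2 t ^+ 2) d /\ d = 2 * (p1 0 * dp1 + p2 0 * dp2).
  by eexists; split; [differentiate|rewrite /GRing.scale /=; ring].
suff : d = 0 by rewrite dE; lra.
rewrite -(derive_is hd); transitivity ('D_(1 : R) (cst (1 : R)) (0 : R)).
  exact: near_eq_derive.
exact: derive_cst.
Qed.

End curves.

Section suspension.
Context {R : realType}.

(** The coordinates [(x_1, y_1)] of [l] after the contact dilation
    [(x, y, z) |-> (a x, a y, a ^ 2 z)]. *)
Definition lead {k} (a : R) (l : contact_space R k.+1) : R * R :=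
  (a * l.1.1 ord0 ord0, a * l.1.2 ord0 ord0).

(** Only [(x_1, y_1)] interacts with the circle.  In the image the first two
    positions, the first two momenta and a correction of the height are given
    by [c]; the other coordinates of [l] are just dilated by [a]. *)
Definition suspend {k} (a : R) (c : (R * R) * (R * R) * R)
    (l : contact_space R k.+1) : contact_space R k.+2 :=
  (row_mx (\row_(_ < 1) c.1.1.1)
     (\row_j if j == ord0 then c.1.1.2 else a * l.1.1 ord0 j),
   row_mx (\row_(_ < 1) c.1.2.1)
     (\row_j if j == ord0 then c.1.2.2 else a * l.1.2 ord0 j),
   a ^+ 2 * l.2 + c.2).

Definition plane {k} (q : contact_space R k.+2) : (R * R) * (R * R) :=
  ((q.1.1 ord0 (lshift k.+1 (ord0 : 'I_1)), q.1.1 ord0 (rshift 1 ord0)),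
   (q.1.2 ord0 (lshift k.+1 (ord0 : 'I_1)), q.1.2 ord0 (rshift 1 ord0))).

Lemma plane_suspend k a c (l : contact_space R k.+1) :
  plane (suspend a c l) = c.1.
Proof.
case: c => [[[? ?] [? ?]] ?]; congr (_, _, (_, _));
  by rewrite [LHS]row_mxEl mxE || rewrite [LHS]row_mxEr mxE.
Qed.

Lemma suspend_x k a c (l : contact_space R k.+1) (j : 'I_k.+1) : j != ord0 ->
  (suspend a c l).1.1 ord0 (rshift 1 j) = a * l.1.1 ord0 j.
Proof. by move=> /negbTE j0; rewrite [LHS]row_mxEr mxE j0. Qed.

Lemma suspend_y k a c (l : contact_space R k.+1) (j : 'I_k.+1) : j != ord0 ->
  (suspend a c l).1.2 ord0 (rshift 1 j) = a * l.1.2 ord0 j.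
Proof. by move=> /negbTE j0; rewrite [LHS]row_mxEr mxE j0. Qed.

Lemma smooth_at_lead {V : normedModType R} {k} (x : V) (a : V -> R)
    (l : V -> contact_space R k.+1) :
  smooth_at x a -> smooth_at x l -> smooth_at x (fun y => lead (a y) (l y)).
Proof.
move=> sa sl.
have s1 := smooth_at_comp (finite_dim_contact _) sl (smooth_at_fst _).
have fd : finite_dim ('rV[R]_k.+1 * 'rV[R]_k.+1)%type.
  exact: finite_dimX (finite_dim_rV _) (finite_dim_rV _).
have s11 := smooth_at_comp fd s1 (smooth_at_fst _).
have s12 := smooth_at_comp fd s1 (smooth_at_snd _).
apply: smooth_at_pair; apply: smooth_atM => //.
  exact: smooth_at_comp (finite_dim_rV _) s11 (smooth_at_coord _ _).
exact: smooth_at_comp (finite_dim_rV _) s12 (smooth_at_coord _ _).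
Qed.

Lemma smooth_at_row_mx {V : normedModType R} m n (x : V) (f : V -> 'rV[R]_m)
    (g : V -> 'rV[R]_n) :
  smooth_at x f -> smooth_at x g -> smooth_at x (fun y => row_mx (f y) (g y)).
Proof.
move=> sf sg; apply: smooth_at_rV => j; under eq_fun do rewrite mxE.
case: (fintype.split j) => i.
  exact: smooth_at_comp (finite_dim_rV _) sf (smooth_at_coord _ _).
exact: smooth_at_comp (finite_dim_rV _) sg (smooth_at_coord _ _).
Qed.

Lemma smooth_at_suspend {V : normedModType R} {k} (x : V) (a : V -> R)
    (c : V -> (R * R) * (R * R) * R) (l : V -> contact_space R k.+1) :
  smooth_at x a -> smooth_at x c -> smooth_at x l ->
  smooth_at x (fun y => suspend (a y) (c y) (l y)).
Proof.
move=> sa sc sl.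
have f2 : finite_dim (R * R)%type by exact: finite_dimX.
have f4 : finite_dim ((R * R) * (R * R))%type by exact: finite_dimX.
have f5 : finite_dim ((R * R) * (R * R) * R)%type by exact: finite_dimX.
have c1 := smooth_at_comp f5 sc (smooth_at_fst _).
have c2 := smooth_at_comp f5 sc (smooth_at_snd _).
have c11 := smooth_at_comp f4 c1 (smooth_at_fst _).
have c12 := smooth_at_comp f4 c1 (smooth_at_snd _).
have s1 := smooth_at_comp (finite_dim_contact _) sl (smooth_at_fst _).
have s2 := smooth_at_comp (finite_dim_contact _) sl (smooth_at_snd _).
have fd : finite_dim ('rV[R]_k.+1 * 'rV[R]_k.+1)%type.
  exact: finite_dimX (finite_dim_rV _) (finite_dim_rV _).
have s11 := smooth_at_comp fd s1 (smooth_at_fst _).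
have s12 := smooth_at_comp fd s1 (smooth_at_snd _).
apply: smooth_at_pair; first apply: smooth_at_pair.
- apply: (@smooth_at_row_mx _ 1 k.+1); apply: smooth_at_rV => j; under eq_fun do rewrite mxE.
    exact: smooth_at_comp f2 c11 (smooth_at_fst _).
  case: (j == ord0); first exact: smooth_at_comp f2 c11 (smooth_at_snd _).
  apply: smooth_atM sa _.
  exact: smooth_at_comp (finite_dim_rV _) s11 (smooth_at_coord _ _).
- apply: (@smooth_at_row_mx _ 1 k.+1); apply: smooth_at_rV => j; under eq_fun do rewrite mxE.
    exact: smooth_at_comp f2 c12 (smooth_at_fst _).
  case: (j == ord0); first exact: smooth_at_comp f2 c12 (smooth_at_snd _).
  apply: smooth_atM sa _.
  exact: smooth_at_comp (finite_dim_rV _) s12 (smooth_at_coord _ _).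
- exact: smooth_atD (smooth_atM (smooth_atX _ sa) s2) c2.
Qed.

(** The contact condition along [l] removes all coordinates of [l] but the
    first pair, so the contact form of the suspension is computed in [R ^ 5]. *)
Lemma contact_form_suspend k (a : R) (c : R -> (R * R) * (R * R) * R)
    (l : R -> contact_space R k.+1) :
  smooth_at 0 c -> smooth_at 0 l ->
  contact_form (l 0) ('D_1 l 0) = 0 ->
  contact_form (suspend a (c 0) (l 0)) ('D_1 (fun t => suspend a (c t) (l t)) 0)
  = 'D_1 (fun t => (c t).2) 0
    + (lead a (l 0)).2 * 'D_1 (fun t => (lead a (l t)).1) 0
    - (c 0).1.2.1 * 'D_1 (fun t => (c t).1.1.1) 0
    - (c 0).1.2.2 * 'D_1 (fun t => (c t).1.1.2) 0.
Proof.
move=> sc sl; have dl := smooth_at_diff sl.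
have dS := smooth_at_diff (smooth_at_suspend (@smooth_at_cst R R R 0 a) sc sl).
have [lx ly lz] := differentiable_coordinates dl.
have c2 : differentiable (fun t => (c t).2) 0.
  exact: (differentiable_comp (smooth_at_diff sc) (smooth_at_diff (smooth_at_snd (c 0)))).
have Da (r : R) (f : R -> R) : differentiable f 0 ->
    'D_1 (fun t => r * f t) 0 = r * 'D_1 f 0.
  by move=> df; apply: (@deriveZ _ _ _ f); exact: diff_derivable.
rewrite !contact_form_derive// => L0.
rewrite (@big_split_ord _ _ _ 1 k.+1) big_ord1 big_ord_recl.
have X1 : (fun s => (suspend a (c s) (l s)).1.1 ord0 (lshift k.+1 (ord0 : 'I_1)))
    = fun s => (c s).1.1.1.
  by apply/funext => s; rewrite [LHS]row_mxEl mxE.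
have X2 : (fun s => (suspend a (c s) (l s)).1.1 ord0 (rshift 1 ord0))
    = fun s => (c s).1.1.2.
  by apply/funext => s; rewrite [LHS]row_mxEr mxE.
have Y1 : (suspend a (c 0) (l 0)).1.2 ord0 (lshift k.+1 (ord0 : 'I_1)) = (c 0).1.2.1.
  by rewrite [LHS]row_mxEl mxE.
have Y2 : (suspend a (c 0) (l 0)).1.2 ord0 (rshift 1 ord0) = (c 0).1.2.2.
  by rewrite [LHS]row_mxEr mxE.
rewrite X1 X2 Y1 Y2.
under eq_bigr => i _.
  under eq_fun do rewrite suspend_x//.
  rewrite suspend_y// Da// mulrACA -expr2.
  over.
rewrite -mulr_sumr.
have -> : 'D_1 (fun s => (suspend a (c s) (l s)).2) 0 =
    a ^+ 2 * 'D_1 (fun s => (l s).2) 0 + 'D_1 (fun s => (c s).2) 0.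
  rewrite -Da// /suspend /=; apply: (@deriveD _ _ _ (fun s => a ^+ 2 * (l s).2)).
    by apply: diff_derivable; apply: (@differentiableZ _ _ _ (fun s => (l s).2)).
  exact: diff_derivable.
move: L0; rewrite big_ord_recl /lead /= Da// => /eqP.
rewrite subr_eq0 => /eqP ->.
move: ('D_1 (fun s => (l s).1.1 ord0 ord0) 0) => u'.
move: ('D_1 (fun s => (c s).1.1.1) 0) ('D_1 (fun s => (c s).1.1.2) 0) => X1' X2'.
ring.
Qed.

End suspension.

(** * Isotopies of suspensions *)

Section suspend_isotopy.
Context {R : realType} {k : nat}.
Context (L : set (contact_space R k.+1)) (kap : R -> R)
  (core : R * ((R * R) * (R * R)) -> (R * R) * (R * R) * R).

Definition suspension_family (t : R) (pl : (R * R) * contact_space R k.+1) :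
    contact_space R k.+2 :=
  suspend (kap t) (core (t, (pl.1, lead (kap t) pl.2))) pl.2.

(** With [core = (X, Y, zeta)], this says [d zeta + v du = Y dX] on the circle
    times the [(u, v)] plane. *)
Definition pulls_back_core (t : R) : Prop :=
  forall (p1 p2 u v : R -> R) (dp1 dp2 du dv : R),
    is_derive (0 : R) (1 : R) p1 dp1 -> is_derive (0 : R) (1 : R) p2 dp2 ->
    is_derive (0 : R) (1 : R) u du -> is_derive (0 : R) (1 : R) v dv ->
    p1 0 ^+ 2 + p2 0 ^+ 2 = 1 -> p1 0 * dp1 + p2 0 * dp2 = 0 ->
    (exists2 l, L l & (u 0, v 0) = lead (kap t) l) ->
    let c x := core (t, ((p1 x, p2 x), (u x, v x))) in
    'D_1 (fun x => (c x).2) 0 + v 0 * du =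
    (c 0).1.2.1 * 'D_1 (fun x => (c x).1.1.1) 0 +
    (c 0).1.2.2 * 'D_1 (fun x => (c x).1.1.2) 0.

Lemma lead_inj a (l m : contact_space R k.+1) : a != 0 -> lead a l = lead a m ->
  l.1.1 ord0 ord0 = m.1.1 ord0 ord0 /\ l.1.2 ord0 ord0 = m.1.2 ord0 ord0.
Proof. by move=> a0 [/(mulfI a0) ? /(mulfI a0) ?]. Qed.

(** Reduction of [isotopy_of_family] to the circle times the [(u, v)] plane.
    Injectivity alone involves the other coordinates and the height, as double
    points of the Lagrangian projection may be separated by them. *)
Lemma suspend_isotopy :
  closed_legendrian L ->
  (forall t, 0 <= t <= 1 -> kap t != 0) -> (forall t, smooth_at t kap) ->
  (forall t p l, 0 <= t <= 1 -> unit_circle p -> L l ->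
     smooth_at (t, (p, lead (kap t) l)) core) ->
  (forall t p q l m, 0 <= t <= 1 -> unit_circle p -> unit_circle q ->
     L l -> L m ->
     (forall j, j != ord0 -> l.1.1 ord0 j = m.1.1 ord0 j /\
                             l.1.2 ord0 j = m.1.2 ord0 j) ->
     (core (t, (p, lead (kap t) l))).1 = (core (t, (q, lead (kap t) m))).1 ->
     kap t ^+ 2 * l.2 + (core (t, (p, lead (kap t) l))).2 =
     kap t ^+ 2 * m.2 + (core (t, (q, lead (kap t) m))).2 ->
     p = q /\ lead (kap t) l = lead (kap t) m) ->
  (forall t p l, 0 <= t <= 1 -> unit_circle p -> L l ->
     exists (P : set ((R * R) * (R * R))) g,
     [/\ open P, P (p, lead (kap t) l),
         smooth_at (core (t, (p, lead (kap t) l))).1 g &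
         forall q m, unit_circle q -> L m -> P (q, lead (kap t) m) ->
           g (core (t, (q, lead (kap t) m))).1 = (q, lead (kap t) m)]) ->
  (forall t, 0 <= t <= 1 -> pulls_back_core t) ->
  legendrian_isotopic (suspension_family 0 @` (unit_circle `*` L))
                      (suspension_family 1 @` (unit_circle `*` L)).
Proof.
move=> [[mL tL] cL] kap0 skap score inj loc pb.
have fR2 : finite_dim (R * R)%type by exact: finite_dimX.
have fR4 : finite_dim ((R * R) * (R * R))%type by exact: finite_dimX.
have fV : finite_dim ((R * R) * contact_space R k.+1)%type.
  exact: finite_dimX fR2 (finite_dim_contact _).
apply: isotopy_of_family => //.
- exact: compact_setX compact_unit_circle cL.
- exact: (@submanifoldX _ _ _ 1 k.+1) fR2 (finite_dim_contact _) submanifold_unit_circle mL.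
- apply: smooth_atW => -[t [p l]] /= [t01 [/= Sp Ll]].
  have s1 := @smooth_at_fst _ R _ (t, (p, l)).
  have s2 := @smooth_at_snd _ R _ (t, (p, l)).
  have sp := smooth_at_comp fV s2 (smooth_at_fst _).
  have sl := smooth_at_comp fV s2 (smooth_at_snd _).
  have sk := smooth_at_comp finite_dimR s1 (skap _).
  apply: smooth_at_suspend => //.
  apply: (@smooth_at_comp _ _ _ _ (t, (p, l))
     (fun tp => (tp.1, (tp.2.1, lead (kap tp.1) tp.2.2))) core).
  + exact: finite_dimX finite_dimR fR4.
  + exact: smooth_at_pair s1 (smooth_at_pair sp (smooth_at_lead sk sl)).
  + exact: score.
- move=> t t01 [p l] [q m] [/= Sp Ll] [/= Sq Lm] E.
  have k0 := kap0 t t01.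
  have E1 := congr1 (@plane _ _) E; rewrite !plane_suspend /= in E1.
  have others j : j != ord0 -> l.1.1 ord0 j = m.1.1 ord0 j /\
                               l.1.2 ord0 j = m.1.2 ord0 j.
    move=> j0; split.
      have := congr1 (fun q : contact_space R k.+2 => q.1.1 ord0 (rshift 1 j)) E.
      by rewrite /suspension_family !suspend_x// => /(mulfI k0).
    have := congr1 (fun q : contact_space R k.+2 => q.1.2 ord0 (rshift 1 j)) E.
    by rewrite /suspension_family !suspend_y// => /(mulfI k0).
  have E2 := congr1 snd E; rewrite /= in E2.
  have [pq lm] := inj t p q l m t01 Sp Sq Ll Lm others E1 E2.
  have [lx ly] := lead_inj k0 lm.
  rewrite pq; congr (_, _); rewrite pq lm in E2.
  move/addIr/(mulfI (expf_neq0 2 k0)) in E2.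
  case: l m lx ly others E2 {Ll Lm E E1 lm} => [[x y] z] [[x' y'] z'] /= lx ly others ->.
  congr (_, _, _); apply/rowP => j; have [->//|j0] := eqVneq j ord0.
    by have [] := others j j0.
  by have [] := others j j0.
- move=> t t01 [p l] [/= Sp Ll]; have k0 := kap0 t t01.
  have [P [g [oP Ppl sg gK]]] := loc t p l t01 Sp Ll.
  pose w (pl : (R * R) * contact_space R k.+1) := (pl.1, lead (kap t) pl.2).
  have sw pl : smooth_at pl w.
    apply: smooth_at_pair (smooth_at_fst _) _.
    exact: smooth_at_lead (smooth_at_cst _ _) (smooth_at_snd _).
  pose rest (a b : R) (q : contact_space R k.+2) : contact_space R k.+1 :=
    (\row_j (if j == ord0 then a / kap t else q.1.1 ord0 (rshift 1 j) / kap t),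
     \row_j (if j == ord0 then b / kap t else q.1.2 ord0 (rshift 1 j) / kap t),
     (q.2 - (core (t, g (plane q))).2) / kap t ^+ 2).
  exists (w @^-1` P),
    (fun q => ((g (plane q)).1, rest (g (plane q)).2.1 (g (plane q)).2.2 q)).
  split=> //.
  + by apply: open_comp => // pl _; exact: smooth_at_cont (sw pl).
  + set Q := suspension_family t (p, l).
    have QE : plane Q = (core (t, (p, lead (kap t) l))).1 by exact: plane_suspend.
    have s1 := smooth_at_fst Q.
    have fd : finite_dim ('rV[R]_k.+2 * 'rV[R]_k.+2)%type.
      exact: finite_dimX (finite_dim_rV _) (finite_dim_rV _).
    have sx i := smooth_at_comp (finite_dim_rV _)
      (smooth_at_comp fd s1 (smooth_at_fst _)) (smooth_at_coord _ i).
    have sy i := smooth_at_comp (finite_dim_rV _)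
      (smooth_at_comp fd s1 (smooth_at_snd _)) (smooth_at_coord _ i).
    have splane : smooth_at Q (@plane R k).
      by apply: smooth_at_pair; apply: smooth_at_pair; [exact: sx|exact: sx|exact: sy|exact: sy].
    have sgp : smooth_at Q (fun q => g (plane q)).
      by apply: smooth_at_comp fR4 splane _; rewrite QE.
    have sg1 := smooth_at_comp fR4 sgp (smooth_at_fst _).
    have sg2 := smooth_at_comp fR4 sgp (smooth_at_snd _).
    have sg21 := smooth_at_comp fR2 sg2 (smooth_at_fst _).
    have sg22 := smooth_at_comp fR2 sg2 (smooth_at_snd _).
    have sc : smooth_at Q (fun q => (core (t, g (plane q))).2).
      have f5 : finite_dim ((R * R) * (R * R) * R)%type by exact: finite_dimX fR4 finite_dimR.
      apply: (smooth_at_comp f5 _ (smooth_at_snd _)).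
      apply: (@smooth_at_comp _ _ _ _ Q (fun q => (t, g (plane q))) core).
      * exact: finite_dimX finite_dimR fR4.
      * exact: smooth_at_pair (smooth_at_cst _ _) sgp.
      * by rewrite QE gK//; exact: score.
    apply: smooth_at_pair sg1 _; apply: smooth_at_pair; first apply: smooth_at_pair.
    * apply: smooth_at_rV => j; under eq_fun do rewrite mxE.
      by case: (j == ord0); apply: smooth_atM _ (smooth_at_cst _ _); [exact: sg21|exact: sx].
    * apply: smooth_at_rV => j; under eq_fun do rewrite mxE.
      by case: (j == ord0); apply: smooth_atM _ (smooth_at_cst _ _); [exact: sg22|exact: sy].
    * apply: smooth_atM _ (smooth_at_cst _ _).
      exact: smooth_atD (smooth_at_snd _) (smooth_atN sc).
  + move=> [q m] [/= Sq Lm] Pqm; rewrite /rest plane_suspend gK//=.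
    case: m Lm Pqm => [[x y] z] Lm Pqm; congr (_, (_, _, _)).
    * apply/rowP => j; rewrite mxE; case: ifPn => [/eqP->|j0].
        by rewrite mulrAC divff ?mul1r.
      by rewrite /suspension_family suspend_x// mulrAC divff ?mul1r.
    * apply/rowP => j; rewrite mxE; case: ifPn => [/eqP->|j0].
        by rewrite mulrAC divff ?mul1r.
      by rewrite /suspension_family suspend_y// mulrAC divff ?mul1r.
    * by rewrite /= addrK mulrAC divff ?mul1r// expf_neq0.
- move=> t t01 e delta e0 sdelta Sdelta.
  have i0 : - e < 0 < e by rewrite oppr_lt0 e0.
  have sd : smooth_at 0 delta.
    apply: smooth_on_open sdelta _ _; first exact: itv_open.
    by rewrite /= in_itv.
  have sp := smooth_at_comp fV sd (smooth_at_fst _).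
  have sl := smooth_at_comp fV sd (smooth_at_snd _).
  have sp1 := smooth_at_comp fR2 sp (smooth_at_fst _).
  have sp2 := smooth_at_comp fR2 sp (smooth_at_snd _).
  have sll := smooth_at_lead (@smooth_at_cst R R R 0 (kap t)) sl.
  have su := smooth_at_comp fR2 sll (smooth_at_fst _).
  have sv := smooth_at_comp fR2 sll (smooth_at_snd _).
  have [S0 L0] := Sdelta 0 i0.
  have dl0 : contact_form (delta 0).2 ('D_1 (fun t => (delta t).2) 0) = 0.
    apply: tL => //; exists e, (fun t => (delta t).2); split=> //.
      apply: (smooth_on_comp fV sdelta (B := setT)) => //.
      by apply: smooth_atW => x _; exact: smooth_at_snd.
    by move=> s /Sdelta[].
  have isd (f : R -> R) : smooth_at 0 f -> is_derive (0 : R) (1 : R) f ('D_1 f 0).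
    by move=> sf; apply/derivableP/diff_derivable; exact: smooth_at_diff.
  have sc : smooth_at 0 (fun s => core (t, ((delta s).1, lead (kap t) (delta s).2))).
    apply: (@smooth_at_comp _ _ _ _ 0 (fun s => (t, ((delta s).1, lead (kap t) (delta s).2))) core).
    + exact: finite_dimX finite_dimR fR4.
    + exact: smooth_at_pair (smooth_at_cst _ _) (smooth_at_pair sp sll).
    + exact: score.
  have circ : (delta 0).1.1 * 'D_1 (fun s => (delta s).1.1) 0 +
              (delta 0).1.2 * 'D_1 (fun s => (delta s).1.2) 0 = 0.
    apply: (unit_circle_derive (isd _ sp1) (isd _ sp2)).
    near=> s; rewrite -surjective_pairing; apply: (Sdelta s _).1.
    apply/andP; split; near: s; last exact: lt_nbhsl.
    by apply: lt_nbhsr; rewrite oppr_lt0.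
  have := pb t t01 _ _ _ _ _ _ _ _ (isd _ sp1) (isd _ sp2) (isd _ su) (isd _ sv) S0 circ.
  move=> /(_ (ex_intro2 _ _ _ L0 erefl)).
  have -> : (fun x => core (t, (((delta x).1.1, (delta x).1.2),
      ((lead (kap t) (delta x).2).1, (lead (kap t) (delta x).2).2)))) =
    fun x => core (t, ((delta x).1, lead (kap t) (delta x).2)).
    by apply/funext => x; rewrite -!surjective_pairing.
  have H := contact_form_suspend (kap t) sc sl dl0.
  by move=> /= E; apply: etrans H _; rewrite /= E; ring.
Unshelve. all: by end_near. Qed.

End suspend_isotopy.

(** * Unwinding the Whitney curve *)

Section unwind.
Context {R : realType}.

(** Write [w = (u, v)].  For the front [z = g (x)] of a Legendrian curve,
    [F (x_1; eta) + g (x_2 - s * eta)], with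
    [F (x; eta) = x ^ 2 * eta / 2 + eta ^ 3 / 6 - eta / 2], is a generating family
    of a Legendrian surface, the product with the Whitney curve if [s = 0].  Its
    fibre critical set is the circle [x_1 ^ 2 + eta ^ 2 = 1 + 2 * s * v].  For
    [s = 1] the shear [y -= dF (x), z -= F (x)] flattens the central circle of
    the surface; if moreover the shift by [u] in [x_2] is removed, the result is
    the spun front of a curve turned by a right angle.  All this is done at once:
    only the multiple [mu] of [F] and of the shift is kept, and the formulas are
    conjugated by the linear symplectic map [(x_2, y_2) |-> (x_2 / s, s * y_2)],
    which turns [s = 1] into [0 < s].  The choice of [mu] makes the coefficients
    polynomial in [s], with [s ^ 3 * io + mu ^ 2 = 1] and [io = 0] at [s = 0].
    Replacing [(u, v)] by the symplectically equivalent [(uh, vh)] gives the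
    circle the rational radius [rho]. *)
Definition unwind (s : R) (p w : R * R) : (R * R) * (R * R) * R :=
  let mu := 1 - s ^+ 4 in let io := s * (2 - s ^+ 4) in
  let rho := 1 + s * w.2 in
  let uh := w.1 / rho in let vh := w.2 + s * w.2 ^+ 2 / 2 in
  let x1 := rho * p.1 in let eta := rho * p.2 in
  ((x1, s * eta + mu * uh),
   (x1 * (mu * eta - s ^+ 2 * io * uh),
    mu * vh - s * io * uh * eta - io * mu * uh ^+ 2 / 2),
   uh * vh * mu ^+ 2 - rho * uh * w.2 + mu * (s * vh * eta - eta ^+ 3 / 3)
   - s * io * mu * uh ^+ 2 * eta / 2 - io * mu ^+ 2 * uh ^+ 3 / 6).

Lemma smooth_at_unwind {V : normedModType R} (x : V) (s p1 p2 u v : V -> R) :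
  smooth_at x s -> smooth_at x p1 -> smooth_at x p2 -> smooth_at x u ->
  smooth_at x v -> 1 + s x * v x != 0 ->
  smooth_at x (fun y => unwind (s y) (p1 y, p2 y) (u y, v y)).
Proof. by move=> ss sp1 sp2 su sv nz; rewrite /unwind /=; smooth. Qed.

Lemma unwind_contact (s : R) (p1 p2 u v : R -> R) (dp1 dp2 du dv : R) :
  is_derive (0 : R) (1 : R) p1 dp1 -> is_derive (0 : R) (1 : R) p2 dp2 ->
  is_derive (0 : R) (1 : R) u du -> is_derive (0 : R) (1 : R) v dv ->
  p1 0 ^+ 2 + p2 0 ^+ 2 = 1 -> p1 0 * dp1 + p2 0 * dp2 = 0 ->
  1 + s * v 0 != 0 ->
  let c x := unwind s (p1 x, p2 x) (u x, v x) in
  'D_1 (fun x => (c x).2) 0 + v 0 * du =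
  (c 0).1.2.1 * 'D_1 (fun x => (c x).1.1.1) 0 +
  (c 0).1.2.2 * 'D_1 (fun x => (c x).1.1.2) 0.
Proof.
move=> h1 h2 hu hv p12 dp nz c.
pose rho x := 1 + s * v x; pose uh x := u x / rho x.
pose x1 x := rho x * p1 x; pose eta x := rho x * p2 x.
have hrho : is_derive (0 : R) (1 : R) rho (s * dv).
  have -> : s * dv = 0 + (s * dv + v 0 * 0) by ring.
  by rewrite /rho; differentiate.
pose duh := (du - uh 0 * (s * dv)) / rho 0.
have huh : is_derive (0 : R) (1 : R) uh duh.
  have -> : duh = u 0 * (- (rho 0) ^- 2 * (s * dv)) + (rho 0)^-1 * du.
    by rewrite /duh /uh; field.
  by rewrite /uh; differentiate.
have duE : du = rho 0 * duh + uh 0 * (s * dv) by rewrite /duh; field.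
have hx1 : is_derive (0 : R) (1 : R) x1 (rho 0 * dp1 + p1 0 * (s * dv)).
  by rewrite /x1; differentiate.
have heta : is_derive (0 : R) (1 : R) eta (rho 0 * dp2 + p2 0 * (s * dv)).
  by rewrite /eta; differentiate.
have x1dx1 : x1 0 * (rho 0 * dp1 + p1 0 * (s * dv)) =
    rho 0 * (s * dv) - eta 0 * (rho 0 * dp2 + p2 0 * (s * dv)).
  rewrite /x1 /eta.
  have -> : rho 0 * p1 0 * (rho 0 * dp1 + p1 0 * (s * dv)) =
    rho 0 ^+ 2 * (p1 0 * dp1 + p2 0 * dp2) +
    rho 0 * (s * dv) * (p1 0 ^+ 2 + p2 0 ^+ 2) -
    rho 0 * p2 0 * (rho 0 * dp2 + p2 0 * (s * dv)) by ring.
  by rewrite dp p12; ring.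
have -> : 'D_1 (fun x => (c x).1.1.1) 0 = rho 0 * dp1 + p1 0 * (s * dv).
  exact: derive_is hx1.
pose mu := 1 - s ^+ 4; pose io := s * (2 - s ^+ 4).
have [dx2 [hx2 dx2E]] : exists d, is_derive (0 : R) (1 : R)
    (fun x => s * eta x + mu * uh x) d /\
    d = s * (rho 0 * dp2 + p2 0 * (s * dv)) + mu * duh.
  by eexists; split; [differentiate|rewrite /GRing.scale /=; ring].
pose vh x := v x + s * v x ^+ 2 / 2.
have hvh : is_derive (0 : R) (1 : R) vh (rho 0 * dv).
  have [d [h dE]] : exists d, is_derive (0 : R) (1 : R) vh d /\ d = rho 0 * dv.
    by eexists; split; [rewrite /vh; differentiate|rewrite /GRing.scale /= /rho; field].
  by rewrite -dE.
have [dz [hz dzE]] : exists d, is_derive (0 : R) (1 : R) (fun x =>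
   uh x * vh x * mu ^+ 2 - rho x * uh x * v x + mu * (s * vh x * eta x - eta x ^+ 3 / 3)
   - s * io * mu * uh x ^+ 2 * eta x / 2 - io * mu ^+ 2 * uh x ^+ 3 / 6) d /\
   d = (duh * vh 0 + uh 0 * (rho 0 * dv)) * mu ^+ 2
     - (s * dv * uh 0 * v 0 + rho 0 * duh * v 0 + rho 0 * uh 0 * dv)
     + mu * (s * (rho 0 * dv) * eta 0 + (s * vh 0 - eta 0 ^+ 2) * (rho 0 * dp2 + p2 0 * (s * dv)))
     - s * io * mu / 2 * (2 * uh 0 * duh * eta 0 + uh 0 ^+ 2 * (rho 0 * dp2 + p2 0 * (s * dv)))
     - io * mu ^+ 2 / 2 * uh 0 ^+ 2 * duh.
  by eexists; split; [differentiate|rewrite /GRing.scale /=; field].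
have -> : 'D_1 (fun x => (c x).1.1.2) 0 = dx2 by exact: derive_is hx2.
have -> : 'D_1 (fun x => (c x).2) 0 = dz by exact: derive_is hz.
rewrite dzE dx2E duE /c /unwind /= -/(rho 0) -/(uh 0) -/(x1 0) -/(eta 0) -/(vh 0) -/mu -/io.
rewrite [X in _ = X + _](_ : _ = (mu * eta 0 - s ^+ 2 * io * uh 0) *
  (x1 0 * (rho 0 * dp1 + p1 0 * (s * dv)))); last by ring.
rewrite x1dx1.
move: (rho 0 * dp2 + p2 0 * (s * dv)) => deta.
by rewrite /vh /mu /io /rho; field.
Qed.


Definition unwind_rho (s : R) (w : R * R) : R := 1 + s * w.2.
Definition unwind_uh (s : R) (w : R * R) : R := w.1 / unwind_rho s w.

(** The inverse of [unwind s] once the point [(x1, eta)] of the circle and [uh]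
    are known: the radius of the circle gives [v], except for [s = 0], where [v]
    is the second momentum. *)
Definition recover (s eta uh x1 y2 : R) : (R * R) * (R * R) :=
  let rho := Num.sqrt (x1 ^+ 2 + eta ^+ 2) in
  ((x1 / rho, eta / rho), (rho * uh, if s == 0 then y2 else (rho - 1) / s)).

Lemma recover_unwind s p w : unit_circle p -> 0 < unwind_rho s w ->
  recover s (unwind_rho s w * p.2) (unwind_uh s w) (unwind s p w).1.1.1
    (unwind s p w).1.2.2 = (p, w).
Proof.
case: p w => p1 p2 [u v]; rewrite /unit_circle /unwind_uh /unwind_rho /= => p12 r0.
have rn : 1 + s * v != 0 by rewrite gt_eqF.
rewrite /recover /=.
have -> : ((1 + s * v) * p1) ^+ 2 + ((1 + s * v) * p2) ^+ 2 = (1 + s * v) ^+ 2.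
  by rewrite !exprMn -mulrDr p12 mulr1.
rewrite sqrtr_sqr gtr0_norm//; congr (_, _, (_, _)); try by field.
case: ifPn => [/eqP ->|s0]; last by field.
by rewrite !expr0n /=; ring.
Qed.

Lemma smooth_at_recover {V : normedModType R} s (x : V) (eta uh x1 y2 : V -> R) :
  smooth_at x eta -> smooth_at x uh -> smooth_at x x1 -> smooth_at x y2 ->
  0 < x1 x ^+ 2 + eta x ^+ 2 ->
  smooth_at x (fun y => recover s (eta y) (uh y) (x1 y) (y2 y)).
Proof.
move=> se su sx sy r0; rewrite /recover /=.
have rn : Num.sqrt (x1 x ^+ 2 + eta x ^+ 2) != 0 by rewrite gt_eqF// sqrtr_gt0.
by case: (eqVneq s 0) => s0; smooth.
Qed.

(** Off [x1 = 0] the quotient of the first momentum by [x1] and the second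
    position are linear in [(eta, uh)], with determinant
    [s ^ 3 * io + mu ^ 2 = 1]. *)
Lemma unwind_solve s p w : (unwind s p w).1.1.1 != 0 ->
  let c := (unwind s p w).1 in
  unwind_rho s w * p.2 = s ^+ 2 * (s * (2 - s ^+ 4)) * c.1.2 + (1 - s ^+ 4) * (c.2.1 / c.1.1) /\
  unwind_uh s w = (1 - s ^+ 4) * c.1.2 - s * (c.2.1 / c.1.1).
Proof.
move=> x1 c; move: x1; rewrite /c /unwind /= => x1.
have XK (K : R) : (1 + s * w.2) * p.1 * K / ((1 + s * w.2) * p.1) = K.
  by rewrite mulrAC divff// mul1r.
by rewrite !XK -/(unwind_rho s w) -/(unwind_uh s w); split; ring.
Qed.

(** Near [x1 = 0], where the quotient is not available, the square of [eta] is
    still a polynomial in the remaining coordinates. *)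
Lemma unwind_eta2 s p w : unit_circle p -> unwind_rho s w != 0 ->
  let c := (unwind s p w).1 in
  s * (s * (2 - s ^+ 4)) * c.1.2 ^+ 2 + (1 - s ^+ 4) ^+ 2 * (1 - c.1.1 ^+ 2)
    + 2 * (1 - s ^+ 4) * s * c.2.2 = (unwind_rho s w * p.2) ^+ 2.
Proof.
case: p w => p1 p2 [u v]; rewrite /unit_circle /unwind_rho /= => p12 r0.
have -> : ((1 + s * v) * p1) ^+ 2 = (1 + s * v) ^+ 2 * (1 - p2 ^+ 2).
  by rewrite exprMn; congr (_ * _); lra.
by field.
Qed.

Definition unwind_solve_uh (s eta x2 y2 : R) : R :=
  if 1 - s ^+ 4 == 0 then - y2 / (s ^+ 2 * eta) else (x2 - s * eta) / (1 - s ^+ 4).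

Lemma unwind_solve_uhE s p w : unwind_rho s w * p.2 != 0 ->
  unwind_solve_uh s (unwind_rho s w * p.2) (unwind s p w).1.1.2
    (unwind s p w).1.2.2 = unwind_uh s w.
Proof.
rewrite /unwind_solve_uh /unwind /= -/(unwind_rho s w) -/(unwind_uh s w).
move: (unwind_rho s w * p.2) (unwind_uh s w) => eta uh eta0.
case: ifPn => [m0|m0]; last by field.
have s4 : s ^+ 4 = 1 by apply/eqP; rewrite eq_sym -subr_eq0.
have s0 : s != 0 by apply: contra_eqN s4 => /eqP ->; rewrite expr0n /= eq_sym oner_eq0.
by rewrite s4; field; rewrite s0 eta0.
Qed.

(** Two distinct points of a fibre of the Lagrangian projection lie over
    opposite points [(0, h)] and [(0, - h)] of the circle.  Eliminating [u']
    between the equations leaves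
    [z - z' = h * (1 - h ^ 2 / 3 - (s * v) ^ 2) / mu], of absolute value at least
    about [2 / 3], so a small Legendrian factor cannot produce a double point. *)
Lemma unwind_opposite s p q w w' (z z' : R) : 0 <= s <= 1 ->
  `|w.2| <= 1 / 8 -> `|w'.2| <= 1 / 8 -> `|z - z'| <= 1 / 4 ->
  p.1 = 0 -> q.1 = 0 -> p.2 ^+ 2 = 1 -> q.2 = - p.2 ->
  (unwind s p w).1 = (unwind s q w').1 ->
  z + (unwind s p w).2 = z' + (unwind s q w').2 -> False.
Proof.
case: p q w w' => p1 p2 [q1 q2] [u v] [u' v'] /= /andP[s0 s1].
rewrite !ler_norml => /andP[v0 v1] /andP[v0' v1'] /andP[z0 z1] -> -> p22 -> XY Z.
have rho0 : 0 < 1 + s * v by nra.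
have rho0' : 0 < 1 + s * v' by nra.
have vE : v' = v.
  have [s00|sn] := eqVneq s 0.
    have := congr1 (fun c => c.2.2) XY; rewrite /= s00 !expr0n /=.
    move/eqP; rewrite -subr_eq0 => /eqP H.
    by apply: subr0_eq; rewrite -oppr0 -[in RHS]H; ring.
  have C (y : R) : y ^+ 2 = 1 -> unit_circle (0, y).
    by rewrite /unit_circle /= => ->; rewrite expr0n add0r.
  have Cq : unit_circle (0, - p2) by apply: C; rewrite sqrrN.
  have E1 := unwind_eta2 (C _ p22) (lt0r_neq0 rho0 : unwind_rho s (u, v) != 0).
  have E2 := unwind_eta2 Cq (lt0r_neq0 rho0' : unwind_rho s (u', v') != 0).
  have XY' : (unwind s (0, p2) (u, v)).1 = (unwind s (0, - p2) (u', v')).1 := XY.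
  cbv zeta in E1, E2; rewrite XY' E2 in E1; move: E1.
  rewrite /unwind_rho /= !exprMn sqrrN p22 !mulr1 => /eqP.
  rewrite eqrXn2 ?ltW// => /eqP /addrI; exact: mulfI.
have X2 := congr1 (fun c => c.1.2) XY; move: X2 Z {XY rho0' v0' v1'}; rewrite /= vE.
move: {u u'}(u / (1 + s * v)) (u' / (1 + s * v)) => u u' X2 Z.
(* For [mu = 0] the second position already separates the two points. *)
pose mu := 1 - s ^+ 4.
have mu1 : mu <= 1 by rewrite /mu gerBl exprn_ge0.
have mu0 : 0 <= mu by rewrite /mu subr_ge0 exprn_ile1.
have mun : mu != 0.
  apply: contraTneq rho0 => m0.
  have s1E : s = 1.
    have : s ^+ 4 = 1 ^+ 4 by rewrite expr1n; apply/eqP; rewrite eq_sym -subr_eq0; apply/eqP.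
    by move/eqP; rewrite eqrXn2 ?ler01// => /eqP.
  move: X2; rewrite -/mu m0 s1E !mul0r !addr0 !mul1r => X2.
  have p20 : p2 != 0 by apply: contra_eqN p22 => /eqP ->; rewrite expr0n /= eq_sym oner_eq0.
  have : (1 + v) * p2 * 2 = 0 by lra.
  move/eqP; rewrite !mulf_eq0 (negbTE p20) pnatr_eq0 /= !orbF => /eqP ->.
  by rewrite ltxx.
have uE : u' = u + 2 * s * ((1 + s * v) * p2) / mu.
  apply: (mulfI mun); rewrite mulrDr [X in _ = _ + X]mulrC divfK//.
  by move: X2; rewrite -/mu; lra.
have ZE A B : z + A = z' + B -> z - z' = B - A by move=> h; lra.
have p2E : p2 = 1 \/ p2 = - 1.
  by move/eqP: p22; rewrite sqrf_eq1 => /orP[] /eqP; [left|right].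
have zE : (z - z') * mu = (1 + s * v) * p2 * (1 - (1 + s * v) ^+ 2 / 3 - (s * v) ^+ 2).
  by rewrite (ZE _ _ Z) uE /mu; case: p2E => ->; field.
have a0 : - (1 / 8) <= s * v by nra.
have a1 : s * v <= 1 / 8 by nra.
move: (s * v) zE a0 a1 => r h a0 a1.
have f2 : 1 / 2 <= (1 + r) * (1 - (1 + r) ^+ 2 / 3 - r ^+ 2) by nra.
have m1 : (z - z') * mu <= 1 / 4 by nra.
have m2 : - (1 / 4) <= (z - z') * mu by nra.
by case: p2E h => ->; lra.
Qed.

End unwind.

Section unwind_isotopy.
Context {R : realType}.

Lemma unit_circle_x0 (p : R * R) : unit_circle p -> p.1 = 0 -> p.2 ^+ 2 = 1.
Proof. by rewrite /unit_circle /= => + p1; rewrite p1 expr0n add0r. Qed.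

Lemma unwind_injective (s : R) p q w w' : unit_circle p -> unit_circle q ->
  0 < unwind_rho s w -> 0 < unwind_rho s w' ->
  (unwind s p w).1 = (unwind s q w').1 ->
  (p, w) = (q, w') \/ [/\ p.1 = 0, q.1 = 0, p.2 ^+ 2 = 1 & q.2 = - p.2].
Proof.
move=> Cp Cq r0 r0' E.
have [x0|x0] := eqVneq (unwind s p w).1.1.1 0.
  have p10 : p.1 = 0.
    by move/eqP: x0; rewrite /unwind /= mulf_eq0 gt_eqF//= => /eqP.
  have q10 : q.1 = 0.
    by move/eqP: x0; rewrite E /unwind /= mulf_eq0 gt_eqF//= => /eqP.
  have p2 := unit_circle_x0 Cp p10; have q2 := unit_circle_x0 Cq q10.
  have /eqP : p.2 ^+ 2 = q.2 ^+ 2 by rewrite p2 q2.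
  rewrite eqf_sqr => /orP[/eqP pq|/eqP pq]; last first.
    by right; split=> //; rewrite pq opprK.
  left; have p20 : p.2 != 0 by apply: contra_eqN p2 => /eqP ->; rewrite expr0n /= eq_sym oner_eq0.
  have E1 := unwind_eta2 Cp (lt0r_neq0 r0); have E2 := unwind_eta2 Cq (lt0r_neq0 r0').
  cbv zeta in E1, E2; rewrite E E2 in E1; move/eqP: E1.
  rewrite -pq !exprMn p2 !mulr1 eqrXn2 ?ltW// => /eqP rE.
  have e0 : unwind_rho s w * p.2 != 0 by rewrite mulf_neq0 // gt_eqF.
  have e0' : unwind_rho s w' * q.2 != 0 by rewrite rE -pq.
  rewrite -(recover_unwind Cp r0) -(recover_unwind Cq r0').
  rewrite -(unwind_solve_uhE e0) -(unwind_solve_uhE e0').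
  by rewrite E -pq rE.
left; have x0' : (unwind s q w').1.1.1 != 0 by rewrite -E.
have [e1 u1] := unwind_solve x0; have [e2 u2] := unwind_solve x0'.
rewrite -(recover_unwind Cp r0) -(recover_unwind Cq r0').
by rewrite e1 u1 e2 u2 E.
Qed.

Lemma unwind_local_inverse (s : R) p w : unit_circle p -> 0 < unwind_rho s w ->
  exists (P : set ((R * R) * (R * R))) g,
    [/\ open P, P (p, w), smooth_at (unwind s p w).1 g &
        forall q w', unit_circle q -> 0 < unwind_rho s w' -> P (q, w') ->
          g (unwind s q w').1 = (q, w')].
Proof.
move=> Cp r0.
have f2 : finite_dim (R * R)%type by exact: finite_dimX.
have f4 : finite_dim ((R * R) * (R * R))%type by exact: finite_dimX.
set XY := (unwind s p w).1.
have s1 := smooth_at_fst XY; have s2 := smooth_at_snd XY.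
have sX1 := smooth_at_comp f2 s1 (smooth_at_fst _).
have sX2 := smooth_at_comp f2 s1 (smooth_at_snd _).
have sY1 := smooth_at_comp f2 s2 (smooth_at_fst _).
have sY2 := smooth_at_comp f2 s2 (smooth_at_snd _).
have cq (x : (R * R) * (R * R)) : smooth_at x (fun y => y.1.1) /\ smooth_at x (fun y => y.1.2).
  have t1 := smooth_at_fst x.
  by split; [exact: smooth_at_comp f2 t1 (smooth_at_fst _)|
             exact: smooth_at_comp f2 t1 (smooth_at_snd _)].
have rE : XY.1.1 ^+ 2 + (unwind_rho s w * p.2) ^+ 2 = unwind_rho s w ^+ 2.
  by rewrite /XY /unwind /= !exprMn -mulrDr Cp mulr1.
have r20 : 0 < XY.1.1 ^+ 2 + (unwind_rho s w * p.2) ^+ 2.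
  by rewrite rE exprn_gt0.
have [p10|p10] := eqVneq p.1 0; last first.
  pose eta (c : (R * R) * (R * R)) :=
    s ^+ 2 * (s * (2 - s ^+ 4)) * c.1.2 + (1 - s ^+ 4) * (c.2.1 / c.1.1).
  pose uh (c : (R * R) * (R * R)) := (1 - s ^+ 4) * c.1.2 - s * (c.2.1 / c.1.1).
  have x0 : XY.1.1 != 0 by rewrite /XY /unwind /= mulf_neq0// gt_eqF.
  exists [set y | y.1.1 != 0], (fun c => recover s (eta c) (uh c) c.1.1 c.2.2).
  split=> //.
  - apply: (@open_comp _ _ (fun y : (R * R) * (R * R) => y.1.1) [set r | r != 0]).
      by move=> x _; exact: smooth_at_cont (cq x).1.
    exact: open_neq.
  - have [e1 _] := unwind_solve x0.
    apply: smooth_at_recover => //; rewrite ?/eta ?/uh.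
    + by smooth.
    + by smooth.
    + by rewrite -e1.
  - move=> q w' Cq r0' /= q10.
    have x0' : (unwind s q w').1.1.1 != 0 by rewrite /unwind /= mulf_neq0// gt_eqF.
    have [e2 u2] := unwind_solve x0'.
    by rewrite /eta /uh -e2 -u2 recover_unwind.
(* Here [p.2] is [1] or [-1], and it is the sign of [eta] near [p]. *)
have p2 := unit_circle_x0 Cp p10.
pose E (c : (R * R) * (R * R)) :=
  s * (s * (2 - s ^+ 4)) * c.1.2 ^+ 2 + (1 - s ^+ 4) ^+ 2 * (1 - c.1.1 ^+ 2)
    + 2 * (1 - s ^+ 4) * s * c.2.2.
pose eta c := p.2 * Num.sqrt (E c).
have etaE q w' : unit_circle q -> 0 < unwind_rho s w' -> 0 < p.2 * q.2 ->
    eta (unwind s q w').1 = unwind_rho s w' * q.2.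
  move=> Cq r0' pq; rewrite /eta /E (unwind_eta2 Cq (lt0r_neq0 r0')).
  rewrite sqrtr_sqr normrM gtr0_norm// mulrCA; congr (_ * _).
  have p2n : `|p.2| = 1 by apply/eqP; rewrite -sqrp_eq1// real_normK ?num_real ?p2.
  rewrite -[p.2 in LHS]mulr1 -[X in _ * X * _]p2n.
  by rewrite -mulrA -normrM gtr0_norm// mulrA -expr2 p2 mul1r.
have pp : 0 < p.2 * p.2 by rewrite -expr2 p2 ltr01.
have etaXY := etaE p w Cp r0 pp.
have p20 : p.2 != 0 by apply: contraTneq pp => ->; rewrite mulr0 ltxx.
have e0 : eta XY != 0 by rewrite etaXY mulf_neq0// gt_eqF.
exists [set y | 0 < p.2 * y.1.2],
  (fun c => recover s (eta c) (unwind_solve_uh s (eta c) c.1.2 c.2.2) c.1.1 c.2.2).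
split=> //.
- apply: (@open_comp _ _ (fun y : (R * R) * (R * R) => p.2 * y.1.2) [set r | 0 < r]).
    move=> x _; apply: smooth_at_cont.
    exact: smooth_atM (smooth_at_cst _ _) (cq x).2.
  exact: open_gt.
- have E0 : 0 < E XY.
    rewrite /E /XY (unwind_eta2 Cp (lt0r_neq0 r0)) exprn_even_gt0//=.
    by rewrite mulf_neq0// gt_eqF.
  have seta : smooth_at XY eta by rewrite /eta /E; smooth.
  apply: smooth_at_recover => //; last by rewrite etaXY.
  rewrite /unwind_solve_uh; case: (eqVneq (1 - s ^+ 4) 0) => m0.
    have s0 : s != 0.
      by apply: contra_eqN m0 => /eqP ->; rewrite expr0n /= subr0 oner_eq0.
    by smooth; rewrite mulf_neq0// expf_neq0.
  by smooth.
- move=> q w' Cq r0' /= pq; rewrite etaE// unwind_solve_uhE ?recover_unwind//.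
  apply: mulf_neq0; first by rewrite gt_eqF.
  by apply: contraTneq pq => ->; rewrite mulr0 ltxx.
Qed.

(** Time runs backwards through [unwind], from the spun picture to the
    product. *)
Lemma unwind_isotopy k (L : set (contact_space R k.+1)) (kap : R) :
  closed_legendrian L -> 0 < kap ->
  (forall l, L l -> `|kap * l.1.2 ord0 ord0| <= 1 / 8 /\ `|kap ^+ 2 * l.2| <= 1 / 8) ->
  let F := suspension_family (k := k) (fun=> kap)
    (fun q => unwind (1 - q.1) q.2.1 q.2.2) in
  legendrian_isotopic (F 0 @` (unit_circle `*` L)) (F 1 @` (unit_circle `*` L)).
Proof.
move=> cL kap0 small F.
have rho0 t l : 0 <= t <= 1 -> L l -> 0 < unwind_rho (1 - t) (lead kap l).
  move=> /andP[t0 t1] /small[]; rewrite /unwind_rho /lead /= ler_norml => /andP[v0 v1] _.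
  by move: (kap * _) v0 v1 => v v0 v1; nra.
have f2 : finite_dim (R * R)%type by exact: finite_dimX.
have f4 : finite_dim ((R * R) * (R * R))%type by exact: finite_dimX.
apply: suspend_isotopy => //.
- by move=> t _; rewrite gt_eqF.
- by move=> t; exact: smooth_at_cst.
- move=> t p l t01 Cp Ll; set x := (t, (p, lead kap l)).
  have s2 := smooth_at_snd x.
  have sp := smooth_at_comp f4 s2 (smooth_at_fst _).
  have sw := smooth_at_comp f4 s2 (smooth_at_snd _).
  have sp1 := smooth_at_comp f2 sp (smooth_at_fst _).
  have sp2 := smooth_at_comp f2 sp (smooth_at_snd _).
  have su := smooth_at_comp f2 sw (smooth_at_fst _).
  have sv := smooth_at_comp f2 sw (smooth_at_snd _).
  have st : smooth_at x (fun q => 1 - q.1).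
    exact: smooth_atD (smooth_at_cst _ _) (smooth_atN (smooth_at_fst _)).
  have := smooth_at_unwind st sp1 sp2 su sv (lt0r_neq0 (rho0 t l t01 Ll)).
  by under eq_fun do rewrite -!surjective_pairing.
- move=> t p q l m t01 Cp Cq Ll Lm _ /= XY Z.
  have [E|[p10 q10 p22 qp]] :=
    unwind_injective Cp Cq (rho0 t l t01 Ll) (rho0 t m t01 Lm) XY.
    by split; [exact: (congr1 fst E)|exact: (congr1 snd E)].
  have [vl zl] := small l Ll; have [vm zm] := small m Lm.
  have s01 : 0 <= 1 - t <= 1 by case/andP: t01 => t0 t1; apply/andP; split; lra.
  have zz : `|kap ^+ 2 * l.2 - kap ^+ 2 * m.2| <= 1 / 4.
    by apply: le_trans (ler_normB _ _) _; lra.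
  by have [] := @unwind_opposite _ (1 - t) p q (lead kap l) (lead kap m) _ _
    s01 vl vm zz p10 q10 p22 qp XY Z.
- move=> t p l t01 Cp Ll.
  have [P [g [oP Pp sg gK]]] := unwind_local_inverse Cp (rho0 t l t01 Ll).
  by exists P, g; split=> // q m Cq Lm; apply: gK => //; exact: rho0.
- move=> t t01 p1 p2 u v dp1 dp2 du dv h1 h2 hu hv p12 dp [l Ll uvE].
  have nz : 1 + (1 - t) * v 0 != 0.
    by have := rho0 t l t01 Ll; rewrite -uvE => /lt0r_neq0.
  have := unwind_contact h1 h2 hu hv p12 dp nz.
  by cbv beta iota zeta delta [fst snd].
Qed.

End unwind_isotopy.

(** * Turning and shrinking a spun front *)

Section spin_isotopy.
Context {R : realType}.

(** The matrix with rows [(1 - t, t)] and [(- t, 1 - t)] turns the plane by a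
    right angle as [t] goes from [0] to [1]; its determinant [turn_norm t] is
    divided out of the first row to make the path symplectic. *)
Definition turn_norm (t : R) : R := (1 - t) ^+ 2 + t ^+ 2.

Definition spin_radius (b t : R) (w : R * R) : R :=
  b + ((1 - t) * w.1 + t * w.2) / turn_norm t.

(** The spun front of the turned curve: both [X] and [Y] point in the radial
    direction [p]. *)
Definition spin_turn (b t : R) (p w : R * R) : (R * R) * (R * R) * R :=
  let r := spin_radius b t w in let q := (1 - t) * w.2 - t * w.1 in
  ((r * p.1, r * p.2), (q * p.1, q * p.2),
   ((1 - t) * t * (w.2 ^+ 2 - w.1 ^+ 2) / 2 - t ^+ 2 * w.1 * w.2) / turn_norm t).

Definition spin_recover (b t : R) (c : (R * R) * (R * R)) : (R * R) * (R * R) :=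
  let r := Num.sqrt (c.1.1 ^+ 2 + c.1.2 ^+ 2) in
  let q := (c.1.1 * c.2.1 + c.1.2 * c.2.2) / r in
  ((c.1.1 / r, c.1.2 / r),
   ((1 - t) * (r - b) - t * q / turn_norm t, t * (r - b) + (1 - t) * q / turn_norm t)).

Lemma turn_norm_ge_half (t : R) : 1 / 2 <= turn_norm t.
Proof. by rewrite /turn_norm; have := sqr_ge0 (2 * t - 1); nra. Qed.

Lemma turn_norm_neq0 (t : R) : turn_norm t != 0.
Proof. by rewrite gt_eqF//; apply: lt_le_trans (turn_norm_ge_half t); lra. Qed.

Lemma spin_turnK b t p w : unit_circle p -> 0 < spin_radius b t w ->
  spin_recover b t (spin_turn b t p w).1 = (p, w).
Proof.
case: p w => p1 p2 [u v]; rewrite /unit_circle /= => p12 r0.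
have D0 := turn_norm_neq0 t.
rewrite /spin_recover /spin_turn /=; move E : (spin_radius b t (u, v)) r0 => r r0.
have rn : r != 0 by rewrite gt_eqF.
rewrite !exprMn -mulrDr p12 mulr1 sqrtr_sqr gtr0_norm//.
set q := (1 - t) * v - t * u.
have -> : (r * p1 * (q * p1) + r * p2 * (q * p2)) / r = q.
  have -> : r * p1 * (q * p1) + r * p2 * (q * p2) = r * q * (p1 ^+ 2 + p2 ^+ 2) by ring.
  by rewrite p12; field.
have -> : r - b = ((1 - t) * u + t * v) / turn_norm t.
  by rewrite -E /spin_radius /= addrC addKr.
rewrite /q; congr (_, _, (_, _)); try by field.
  by rewrite /turn_norm; field; exact: D0.
by rewrite /turn_norm; field; exact: D0.
Qed.

Lemma smooth_at_spin_recover b t (c : (R * R) * (R * R)) :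
  0 < c.1.1 ^+ 2 + c.1.2 ^+ 2 -> smooth_at c (spin_recover b t).
Proof.
move=> c0; have f2 : finite_dim (R * R)%type by exact: finite_dimX.
have s1 := smooth_at_fst c; have s2 := smooth_at_snd c.
have sX1 := smooth_at_comp f2 s1 (smooth_at_fst _).
have sX2 := smooth_at_comp f2 s1 (smooth_at_snd _).
have sY1 := smooth_at_comp f2 s2 (smooth_at_fst _).
have sY2 := smooth_at_comp f2 s2 (smooth_at_snd _).
have rn : Num.sqrt (c.1.1 ^+ 2 + c.1.2 ^+ 2) != 0 by rewrite gt_eqF// sqrtr_gt0.
have D0 := turn_norm_neq0 t.
by rewrite /spin_recover /=; smooth.
Qed.

Lemma smooth_at_spin_turn {V : normedModType R} (x : V) (b t p1 p2 u v : V -> R) :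
  smooth_at x b -> smooth_at x t -> smooth_at x p1 -> smooth_at x p2 ->
  smooth_at x u -> smooth_at x v ->
  smooth_at x (fun y => spin_turn (b y) (t y) (p1 y, p2 y) (u y, v y)).
Proof.
move=> sb st sp1 sp2 su sv.
have D0 : (1 - t x) ^+ 2 + t x ^+ 2 != 0 := turn_norm_neq0 (t x).
by rewrite /spin_turn /spin_radius /turn_norm /=; smooth.
Qed.

Lemma spin_turn_contact (b t : R) (p1 p2 u v : R -> R) (dp1 dp2 du dv : R) :
  is_derive (0 : R) (1 : R) p1 dp1 -> is_derive (0 : R) (1 : R) p2 dp2 ->
  is_derive (0 : R) (1 : R) u du -> is_derive (0 : R) (1 : R) v dv ->
  p1 0 ^+ 2 + p2 0 ^+ 2 = 1 -> p1 0 * dp1 + p2 0 * dp2 = 0 ->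
  let c x := spin_turn b t (p1 x, p2 x) (u x, v x) in
  'D_1 (fun x => (c x).2) 0 + v 0 * du =
  (c 0).1.2.1 * 'D_1 (fun x => (c x).1.1.1) 0 +
  (c 0).1.2.2 * 'D_1 (fun x => (c x).1.1.2) 0.
Proof.
move=> h1 h2 hu hv p12 dp c; have D0 := turn_norm_neq0 t.
pose r x := spin_radius b t (u x, v x).
have [dr [hr drE]] : exists d, is_derive (0 : R) (1 : R) r d /\
    d = ((1 - t) * du + t * dv) / turn_norm t.
  eexists; split; [rewrite /r /spin_radius /=; differentiate|rewrite /GRing.scale /=; field; exact: D0].
have [dx1 [hx1 dx1E]] : exists d, is_derive (0 : R) (1 : R) (fun x => r x * p1 x) d /\
    d = r 0 * dp1 + p1 0 * dr.
  by eexists; split; [differentiate|rewrite /GRing.scale /=; ring].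
have [dx2 [hx2 dx2E]] : exists d, is_derive (0 : R) (1 : R) (fun x => r x * p2 x) d /\
    d = r 0 * dp2 + p2 0 * dr.
  by eexists; split; [differentiate|rewrite /GRing.scale /=; ring].
have [dz [hz dzE]] : exists d, is_derive (0 : R) (1 : R) (fun x =>
   ((1 - t) * t * (v x ^+ 2 - u x ^+ 2) / 2 - t ^+ 2 * u x * v x) / turn_norm t) d /\
    d = ((1 - t) * t * (v 0 * dv - u 0 * du) - t ^+ 2 * (u 0 * dv + v 0 * du)) / turn_norm t.
  eexists; split; [differentiate|rewrite /GRing.scale /=; field; exact: D0].
have -> : 'D_1 (fun x => (c x).1.1.1) 0 = dx1 by exact: derive_is hx1.
have -> : 'D_1 (fun x => (c x).1.1.2) 0 = dx2 by exact: derive_is hx2.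
have -> : 'D_1 (fun x => (c x).2) 0 = dz by exact: derive_is hz.
rewrite dzE dx1E dx2E /c /spin_turn /=; set q := (1 - t) * v 0 - t * u 0.
have -> : q * p1 0 * (r 0 * dp1 + p1 0 * dr) + q * p2 0 * (r 0 * dp2 + p2 0 * dr) =
   q * r 0 * (p1 0 * dp1 + p2 0 * dp2) + q * dr * (p1 0 ^+ 2 + p2 0 ^+ 2) by ring.
by rewrite dp p12 drE /q /turn_norm; field; exact: D0.
Qed.

Lemma spin_isotopy k (L : set (contact_space R k.+1)) (kap b : R -> R) :
  closed_legendrian L ->
  (forall t, smooth_at t kap) -> (forall t, smooth_at t b) ->
  (forall t, 0 <= t <= 1 -> kap t != 0) ->
  (forall t l, 0 <= t <= 1 -> L l -> 0 < spin_radius (b t) t (lead (kap t) l)) ->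
  let F := suspension_family (k := k) kap
    (fun q => spin_turn (b q.1) q.1 q.2.1 q.2.2) in
  legendrian_isotopic (F 0 @` (unit_circle `*` L)) (F 1 @` (unit_circle `*` L)).
Proof.
move=> cL skap sb kap0 r0 F.
have f2 : finite_dim (R * R)%type by exact: finite_dimX.
have f4 : finite_dim ((R * R) * (R * R))%type by exact: finite_dimX.
apply: suspend_isotopy => //.
- move=> t p l t01 Cp Ll; set x := (t, (p, lead _ l)).
  have s2 := smooth_at_snd x; have st := smooth_at_fst x.
  have sp := smooth_at_comp f4 s2 (smooth_at_fst _).
  have sw := smooth_at_comp f4 s2 (smooth_at_snd _).
  have sp1 := smooth_at_comp f2 sp (smooth_at_fst _).
  have sp2 := smooth_at_comp f2 sp (smooth_at_snd _).
  have su := smooth_at_comp f2 sw (smooth_at_fst _).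
  have sv := smooth_at_comp f2 sw (smooth_at_snd _).
  have sbt := smooth_at_comp finite_dimR st (sb t).
  have := smooth_at_spin_turn sbt st sp1 sp2 su sv.
  by under eq_fun do rewrite -!surjective_pairing.
- move=> t p q l m t01 Cp Cq Ll Lm _ /= XY _.
  have E : (p, lead (kap t) l) = (q, lead (kap t) m).
    rewrite -(spin_turnK Cp (r0 t l t01 Ll)) -(spin_turnK Cq (r0 t m t01 Lm)).
    exact: (congr1 (spin_recover (b t) t) XY).
  by split; [exact: (congr1 fst E)|exact: (congr1 snd E)].
- move=> t p l t01 Cp Ll; exists setT, (spin_recover (b t) t).
  split=> //; first exact: openT.
    apply: smooth_at_spin_recover; rewrite /= !exprMn -mulrDr.
    have -> : p.1 ^+ 2 + p.2 ^+ 2 = 1 by exact: Cp.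
    by rewrite mulr1 exprn_gt0//; exact: r0.
  by move=> q m Cq Lm _; apply: spin_turnK => //; exact: r0.
- move=> t t01 p1 p2 u v dp1 dp2 du dv h1 h2 hu hv p12 dp _.
  have := spin_turn_contact (b t) t h1 h2 hu hv p12 dp.
  by cbv beta iota zeta delta [fst snd].
Qed.

(** With [|u|, |v| <= K], centring the spun curve at distance
    [(1 - t) a + t + 6 K t (1 - t)] keeps it off the axis while it is turned
    by a right angle and shrunk. *)
Lemma spin_radius_gt0 (K lam a u v t : R) : 0 <= t <= 1 -> 0 < lam <= 1 ->
  0 <= K -> 4 * K * lam <= 1 -> `|u| <= K -> `|v| <= K -> 0 < u + a ->
  0 < spin_radius ((1 - t) * a + t + 6 * K * t * (1 - t)) t
        ((1 - t + t * lam) * u, (1 - t + t * lam) * v).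
Proof.
move=> /andP[t0 t1] /andP[l0 l1] K0 Kl.
rewrite !ler_norml => /andP[u0 u1] /andP[v0 v1] ua.
rewrite /spin_radius /=; set D := turn_norm t; have D2 : 1 / 2 <= D := turn_norm_ge_half t.
have Dgt : 0 < D by lra.
have Dn : D != 0 by rewrite gt_eqF.
have DE : D = (1 - t) ^+ 2 + t ^+ 2 by [].
set kp := 1 - t + t * lam; pose e := kp / D.
have -> : ((1 - t) * (kp * u) + t * (kp * v)) / D = (1 - t) * u + (1 - t) * (e - 1) * u + t * e * v.
  by rewrite /e; field.
have k0 : 0 <= kp by rewrite /kp; nra.
have e0 : 0 <= e by rewrite divr_ge0 // ltW.
have e2 : e <= 2 * kp by rewrite ler_pdivrMr//; nra.
have kD : kp - D = t * (1 + lam - 2 * t) by rewrite /kp DE; ring.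
have e1E : e - 1 = t * (1 + lam - 2 * t) / D by rewrite -kD /e; field.
have ep : e - 1 <= 4 * t by rewrite e1E ler_pdivrMr//; nra.
have en : - (4 * t) <= e - 1 by rewrite e1E ler_pdivlMr//; nra.
have A : - (4 * t * (1 - t) * K) <= (1 - t) * (e - 1) * u.
  have : `|(e - 1) * u| <= 4 * t * K.
    by rewrite normrM ler_pM// ler_norml; apply/andP; split.
  rewrite ler_norml => /andP[h _].
  have t'0 : 0 <= 1 - t by lra.
  by have := ler_wpM2l t'0 h; lra.
have B : - (2 * t * (1 - t) * K + t / 2) <= t * e * v.
  have eK : e * K <= 2 * (1 - t) * K + 2 * t * lam * K.
    have := ler_wpM2r K0 e2; rewrite /kp; lra.
  have tlK : 2 * t * lam * K <= 1 / 2 by nra.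
  have ev : - (e * K) <= e * v by have := ler_wpM2l e0 v0; lra.
  have h : - (2 * (1 - t) * K + 1 / 2) <= e * v by lra.
  by have := ler_wpM2l t0 h; lra.
have [tp|tz] := ltP 0 t.
  have : 0 <= (1 - t) * (u + a) by apply: mulr_ge0; lra.
  by lra.
have tE : t = 0 by lra.
by rewrite tE in A B *; lra.
Qed.

End spin_isotopy.

(** * Shrinking a factor of a product *)

Section product_isotopy.
Context {R : realType}.

Definition whitney_product (g b : R) (p w : R * R) : (R * R) * (R * R) * R :=
  ((g * p.1, w.1), (g * (p.2 * p.1), w.2), b - g ^+ 2 * p.2 ^+ 3 / 3).

Lemma whitney_product_contact (g b : R) (p1 p2 u v : R -> R) (dp1 dp2 du dv : R) :
  is_derive (0 : R) (1 : R) p1 dp1 -> is_derive (0 : R) (1 : R) p2 dp2 ->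
  is_derive (0 : R) (1 : R) u du -> is_derive (0 : R) (1 : R) v dv ->
  p1 0 * dp1 + p2 0 * dp2 = 0 ->
  let c x := whitney_product g b (p1 x, p2 x) (u x, v x) in
  'D_1 (fun x => (c x).2) 0 + v 0 * du =
  (c 0).1.2.1 * 'D_1 (fun x => (c x).1.1.1) 0 +
  (c 0).1.2.2 * 'D_1 (fun x => (c x).1.1.2) 0.
Proof.
move=> h1 h2 hu hv dp c.
have [dx1 [hx1 dx1E]] : exists d, is_derive (0 : R) (1 : R) (fun x => g * p1 x) d /\
    d = g * dp1.
  by eexists; split; [differentiate|rewrite /GRing.scale /=; ring].
have [dz [hz dzE]] : exists d, is_derive (0 : R) (1 : R) (fun x =>
   b - g ^+ 2 * p2 x ^+ 3 / 3) d /\ d = - g ^+ 2 * p2 0 ^+ 2 * dp2.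
  by eexists; split; [differentiate|rewrite /GRing.scale /=; field].
have -> : 'D_1 (fun x => (c x).1.1.1) 0 = dx1 by exact: derive_is hx1.
have -> : 'D_1 (fun x => (c x).1.1.2) 0 = du by exact: derive_is hu.
have -> : 'D_1 (fun x => (c x).2) 0 = dz by exact: derive_is hz.
rewrite dzE dx1E /c /=.
have -> : g * (p2 0 * p1 0) * (g * dp1) = g ^+ 2 * p2 0 * (p1 0 * dp1 + p2 0 * dp2)
  - g ^+ 2 * p2 0 ^+ 2 * dp2 by ring.
by rewrite dp; ring.
Qed.

Lemma whitney_product_local_inverse (g b : R) p w : unit_circle p -> g != 0 ->
  exists (P : set ((R * R) * (R * R))) h,
    [/\ open P, P (p, w), smooth_at (whitney_product g b p w).1 h &
        forall q w', unit_circle q -> P (q, w') ->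
          h (whitney_product g b q w').1 = (q, w')].
Proof.
move=> Cp g0.
have f2 : finite_dim (R * R)%type by exact: finite_dimX.
set XY := (whitney_product g b p w).1.
have s1 := smooth_at_fst XY; have s2 := smooth_at_snd XY.
have sX1 := smooth_at_comp f2 s1 (smooth_at_fst _).
have sX2 := smooth_at_comp f2 s1 (smooth_at_snd _).
have sY1 := smooth_at_comp f2 s2 (smooth_at_fst _).
have sY2 := smooth_at_comp f2 s2 (smooth_at_snd _).
have cq (x : (R * R) * (R * R)) : smooth_at x (fun y => y.1.1) /\ smooth_at x (fun y => y.1.2).
  have t1 := smooth_at_fst x.
  by split; [exact: smooth_at_comp f2 t1 (smooth_at_fst _)|
             exact: smooth_at_comp f2 t1 (smooth_at_snd _)].
have [p10|p10] := eqVneq p.1 0; last first.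
  have x0 : XY.1.1 != 0 by rewrite /XY /= mulf_neq0.
  exists [set y | y.1.1 != 0], (fun c => ((c.1.1 / g, c.2.1 / c.1.1), (c.1.2, c.2.2))).
  split=> //.
  - apply: (@open_comp _ _ (fun y : (R * R) * (R * R) => y.1.1) [set r | r != 0]).
      by move=> x _; exact: smooth_at_cont (cq x).1.
    exact: open_neq.
  - by smooth.
  - move=> [q1 q2] [u v] _ /= q10; congr (_, _, _); last by field; rewrite g0 q10.
    by field.
have p2 := unit_circle_x0 Cp p10.
have pp : 0 < p.2 * p.2 by rewrite -expr2 p2 ltr01.
exists [set y | 0 < p.2 * y.1.2],
  (fun c => ((c.1.1 / g, p.2 * Num.sqrt (1 - (c.1.1 / g) ^+ 2)), (c.1.2, c.2.2))).
split=> //.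
- apply: (@open_comp _ _ (fun y : (R * R) * (R * R) => p.2 * y.1.2) [set r | 0 < r]).
    move=> x _; apply: smooth_at_cont.
    exact: smooth_atM (smooth_at_cst _ _) (cq x).2.
  exact: open_gt.
- by smooth => //; rewrite /XY /= p10 mulr0 mul0r expr0n subr0 ltr01.
- move=> [q1 q2] [u v]; rewrite /unit_circle /= => Cq pq.
  have -> : g * q1 / g = q1 by field.
  have -> : 1 - q1 ^+ 2 = q2 ^+ 2 by lra.
  have p2n : `|p.2| = 1 by apply/eqP; rewrite -sqrp_eq1// real_normK ?num_real ?p2.
  congr (_, _, _); rewrite sqrtr_sqr -[p.2]mulr1 -[X in _ * X * _]p2n.
  by rewrite -mulrA -normrM gtr0_norm// mulrA -expr2 p2 mul1r.
Qed.

(** Coinciding points of the product come from a Reeb chord of [L] whose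
    dilated action is the action [2 * g ^ 2 / 3] of the chord of the Whitney
    curve dilated by [g]. *)
Lemma product_isotopy k (L : set (contact_space R k.+1)) (kap g b : R -> R) :
  closed_legendrian L -> (forall c, reeb_chord L c -> action c < 1) ->
  (forall t, smooth_at t kap) -> (forall t, smooth_at t g) ->
  (forall t, smooth_at t b) ->
  (forall t, 0 <= t <= 1 -> [/\ 0 < kap t, 0 < g t & 3 * kap t ^+ 2 <= 2 * g t ^+ 2]) ->
  let F := suspension_family (k := k) kap
    (fun q => whitney_product (g q.1) (b q.1) q.2.1 q.2.2) in
  legendrian_isotopic (F 0 @` (unit_circle `*` L)) (F 1 @` (unit_circle `*` L)).
Proof.
move=> cL chords skap sg sb kg F.
have f2 : finite_dim (R * R)%type by exact: finite_dimX.
have f4 : finite_dim ((R * R) * (R * R))%type by exact: finite_dimX.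
apply: suspend_isotopy => //.
- by move=> t /kg[k0 _ _]; rewrite gt_eqF.
- move=> t p l t01 Cp Ll; set x := (t, (p, lead _ l)).
  have s2 := smooth_at_snd x; have st := smooth_at_fst x.
  have sp := smooth_at_comp f4 s2 (smooth_at_fst _).
  have sw := smooth_at_comp f4 s2 (smooth_at_snd _).
  have sp1 := smooth_at_comp f2 sp (smooth_at_fst _).
  have sp2 := smooth_at_comp f2 sp (smooth_at_snd _).
  have su := smooth_at_comp f2 sw (smooth_at_fst _).
  have sv := smooth_at_comp f2 sw (smooth_at_snd _).
  have sbt := smooth_at_comp finite_dimR st (sb t).
  have sgt := smooth_at_comp finite_dimR st (sg t).
  by rewrite /whitney_product; smooth.
- move=> t p q l m t01 Cp Cq Ll Lm others /= XY Z.
  have [k0 g0 kgle] := kg t t01.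
  have lw : lead (kap t) l = lead (kap t) m.
    by rewrite /lead; case: XY => _ -> _ ->.
  have gn : g t != 0 by rewrite gt_eqF.
  have pq1 : p.1 = q.1 by case: XY => /(mulfI gn).
  have pq2 : p.2 * p.1 = q.2 * q.1 by case: XY => _ _ /(mulfI gn).
  split=> //; case: p q Cp Cq pq1 pq2 Z {XY} => p1 p2 [q1 q2].
  move=> Cp Cq /= pq1; rewrite {}pq1 in Cp *; have [q10|q10] := eqVneq q1 0; last first.
    by move=> /(mulIf q10) ->.
  move=> _; have p22 : p2 ^+ 2 = 1 := unit_circle_x0 Cp q10.
  have q22 : q2 ^+ 2 = 1 := unit_circle_x0 Cq q10.
  have /eqP : p2 ^+ 2 = q2 ^+ 2 by rewrite p22 q22.
  rewrite eqf_sqr => /orP[/eqP -> //|/eqP pq Z]; exfalso.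
  have [lx ly] := lead_inj (lt0r_neq0 k0) lw.
  have lm1 : l.1 = m.1.
    rewrite [LHS]surjective_pairing [RHS]surjective_pairing.
    congr (_, _); apply/rowP => j; have [->//|j0] := eqVneq j ord0.
      by have [] := others j j0.
    by have [] := others j j0.
  have zE : kap t ^+ 2 * (l.2 - m.2) = 2 * g t ^+ 2 / 3 * p2.
    have p23 : p2 ^+ 3 = p2 by rewrite exprS p22 mulr1.
    have q23 : q2 ^+ 3 = - p2 by rewrite exprS q22 mulr1 pq opprK.
    by move: Z; rewrite p23 q23; lra.
  have far (z : R) : kap t ^+ 2 * z = 2 * g t ^+ 2 / 3 -> 1 <= z.
    move=> h; rewrite -(ler_pM2l (exprn_gt0 2 k0)) h mulr1; lra.
  move/eqP: p22; rewrite sqrf_eq1 => /orP[] /eqP p2E.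
    have z1 : 1 <= l.2 - m.2 by apply: far; rewrite zE p2E mulr1.
    have /chords : reeb_chord L (m, l) by split=> //=; lra.
    by rewrite /action /=; lra.
  have z1 : 1 <= m.2 - l.2.
    by apply: far; rewrite -[m.2 - _]opprB mulrN zE p2E; ring.
  have /chords : reeb_chord L (l, m) by split=> //=; lra.
  by rewrite /action /=; lra.
- move=> t p l t01 Cp Ll; have [_ g0 _] := kg t t01.
  have [P [h [oP Pp sh hK]]] :=
    whitney_product_local_inverse (b t) (lead (kap t) l) Cp (lt0r_neq0 g0).
  by exists P, h; split=> // q m Cq Lm; exact: hK.
- move=> t t01 p1 p2 u v dp1 dp2 du dv h1 h2 hu hv p12 dp _.
  have := whitney_product_contact (g t) (b t) h1 h2 hu hv dp.
  by cbv beta iota zeta delta [fst snd].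
Qed.

End product_isotopy.

(** * The Whitney unknot *)

Section whitney.
Context {R : realType}.

Lemma is_derive_shift0 (f : R -> R) (a d : R) :
  is_derive (0 : R) (1 : R) (fun t => f (a + t)) d -> is_derive a (1 : R) f d.
Proof.
move=> H; have fE : f = (fun t => f (a + t)) \o (fun s => s - a).
  by apply/funext => s; rewrite /= addrC subrK.
have hs : is_derive a (1 : R) (fun s : R => s - a) 1.
  have hid : is_derive a (1 : R) (fun s : R => s) 1 := is_derive_id _ _.
  have [d' [hd dE]] : exists d', is_derive a (1 : R) (fun s : R => s - a) d' /\ d' = 1.
    by eexists; split; [differentiate|rewrite /= ?oppr0 ?addr0 ?subr0].
  by rewrite dE in hd.
rewrite fE -[d]mulr1; apply: is_derive1_comp hs.
by rewrite subrr.
Qed.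

(** The contact condition [dz = y dx] determines the height up to a constant,
    and [y dx = c ^ 2 p2 p1 dp1 = - c ^ 2 p2 ^ 2 dp2] along the circle. *)
Lemma whitney_height (c : R) (W : set (contact_space R 1)) (h : R * R -> R) :
  legendrian W -> smooth_on unit_circle h ->
  W = [set (whitney_immersion c p, h p) | p in unit_circle] ->
  exists b, forall p, unit_circle p -> h p = b - c ^+ 2 * p.2 ^+ 3 / 3.
Proof.
move=> [_ tW] sh WE.
pose phi e s := h (stereo e s) + c ^+ 2 * (stereo e s).2 ^+ 3 / 3.
have phi_cst e s s' : e * e = 1 -> phi e s = phi e s'.
  move=> ee; apply: is_derive_0_is_cst => a; apply: is_derive_shift0.
  pose p (t : R) := stereo e (a + t).
  have f2 : finite_dim (R * R)%type by exact: finite_dimX.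
  have sp t : smooth_at t p.
    apply: smooth_at_stereo; exact: smooth_atD (smooth_at_cst _ _) (smooth_at_id _).
  have Cp t : unit_circle (p t) by exact: stereo_unit_circle.
  have sp1 t := smooth_at_comp f2 (sp t) (smooth_at_fst _).
  have sp2 t := smooth_at_comp f2 (sp t) (smooth_at_snd _).
  have shp : smooth_on setT (fun t => h (p t)).
    by apply: (smooth_on_comp f2 _ _ sh) => // ; apply: smooth_atW.
  have shpt t := smooth_on_open openT shp (I : [set: R] t).
  pose gamma (t : R) : contact_space R 1 := (whitney_immersion c (p t), h (p t)).
  have sgamma t : smooth_at t gamma.
    apply: smooth_at_pair => //; apply: smooth_at_pair; apply: smooth_at_rV => j;
      under eq_fun do rewrite mxE.
      by have := sp1 t => s1; smooth.
    by have := sp1 t => s1; have := sp2 t => s2; smooth.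
  have Cp' t : unit_circle ((p t).1, (p t).2) by rewrite -surjective_pairing.
  have g0 : W (gamma 0) by rewrite WE; exists (p 0).
  have : contact_form (gamma 0) ('D_1 gamma 0) = 0.
    apply: tW => //; exists 1, gamma; split=> //.
      by apply: smooth_atW.
    by move=> t _; rewrite WE; exists (p t).
  rewrite (contact_form_derive _ (smooth_at_diff (sgamma 0))) big_ord1.
  have isd0 (f : R -> R) : smooth_at 0 f -> is_derive (0 : R) (1 : R) f ('D_1 f 0).
    by move=> sf; apply/derivableP/diff_derivable; exact: smooth_at_diff.
  have h1 := isd0 _ (sp1 0); have h2 := isd0 _ (sp2 0); have hh := isd0 _ (shpt 0).
  have C : \forall t \near (0 : R), unit_circle ((p t).1, (p t).2) by near=> t.
  have dp := unit_circle_derive h1 h2 C.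
  have -> : (fun s => (gamma s).1.1 ord0 ord0) = (fun s => c * (p s).1).
    by apply/funext => t; rewrite mxE.
  have hc1 : is_derive (0 : R) (1 : R) (fun s => c * (p s).1) (c * 'D_1 (fun s => (p s).1) 0).
    have -> : c * 'D_1 (fun s => (p s).1) 0 = c * 'D_1 (fun s => (p s).1) 0 + (p 0).1 * 0.
      by rewrite mulr0 addr0.
    by apply: is_derive_mul => //; exact: is_derive_const.
  rewrite (derive_is hc1) mxE => dhE.
  have sum_rule (f g : R -> R) df dg :
      is_derive (0 : R) (1 : R) f df -> is_derive (0 : R) (1 : R) g dg ->
      is_derive (0 : R) (1 : R) (fun t => f t + c ^+ 2 * g t ^+ 3 / 3)
        (df + c ^+ 2 * g 0 ^+ 2 * dg).
    move=> hf hg; have [d [hd dE]] : exists d, is_derive (0 : R) (1 : R)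
      (fun t => f t + c ^+ 2 * g t ^+ 3 / 3) d /\ d = df + c ^+ 2 * g 0 ^+ 2 * dg.
      by eexists; split; [differentiate|rewrite /GRing.scale /=; field].
    by rewrite dE in hd.
  have d0E : 0 = 'D_1 (fun t => h (p t)) 0 +
      c ^+ 2 * (p 0).2 ^+ 2 * 'D_1 (fun s => (p s).2) 0.
    transitivity (c ^+ 2 * (p 0).2 * ((p 0).1 * 'D_1 (fun s => (p s).1) 0 +
      (p 0).2 * 'D_1 (fun s => (p s).2) 0)); first by rewrite dp mulr0.
    move/eqP: dhE; rewrite subr_eq0 => /eqP ->.
    move: (p 0) ('D_1 (fun s => (p s).1) 0) ('D_1 (fun s => (p s).2) 0) => [x y] dx dy.
    by rewrite /=; ring.
  have H := sum_rule _ _ _ _ hh h2; rewrite -d0E in H.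
  exact: H.
have n1 : -1 * -1 = 1 :> R by rewrite mulrNN mulr1.
have top e : stereo e 1 = (0, 1).
  by rewrite /stereo expr1n subrr mulr0 mul0r mulr1 divff// pnatr_eq0.
exists (phi 1 1) => q Cq.
have [e [s [ee _ ->]]] := stereo_cover Cq.
have -> : phi 1 1 = phi e 1 by rewrite /phi !top.
by rewrite (phi_cst e 1 s ee) /phi addrK.
Unshelve. all: by end_near. Qed.

(** The two points of the circle over the double point [(0, 0)] bound a chord
    of action [2 * c ^ 2 / 3]. *)
Lemma whitney_scale (c : R) (W : set (contact_space R 1)) (h : R * R -> R) b :
  0 < c -> W = [set (whitney_immersion c p, h p) | p in unit_circle] ->
  (forall p, unit_circle p -> h p = b - c ^+ 2 * p.2 ^+ 3 / 3) ->
  (forall d, reeb_chord W d -> action d = 1) -> 2 * c ^+ 2 = 3.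
Proof.
move=> c0 WE hE act.
have C1 : unit_circle (0, 1 : R) by rewrite /unit_circle /= expr0n expr1n add0r.
have C2 : unit_circle (0, -1 : R) by rewrite /unit_circle /= expr0n sqrrN expr1n add0r.
pose pt p : contact_space R 1 := (whitney_immersion c p, h p).
have c20 : 0 < c ^+ 2 by rewrite exprn_gt0.
have h1 : h (0, 1) = b - c ^+ 2 / 3 by rewrite hE//= expr1n mulr1.
have h2 : h (0, -1) = b + c ^+ 2 / 3.
  by rewrite hE//=; field.
have : action (pt (0, 1), pt (0, -1)) = 1.
  apply: act; split=> /=.
  - by rewrite WE; exists (0, 1).
  - by rewrite WE; exists (0, -1).
  - by rewrite /whitney_immersion /= !mulr0.
  - by rewrite h1 h2; lra.
by rewrite /action /= h1 h2; lra.
Qed.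

End whitney.

Section assembly.
Context {R : realType}.

Lemma compact_smooth_bounded {V : normedModType R} (L : set V) (f : V -> R) :
  compact L -> (forall x, smooth_at x f) ->
  exists2 K, 0 <= K & forall l, L l -> `|f l| <= K.
Proof.
move=> cL sf.
have cf : compact (f @` L).
  by apply: continuous_compact cL; apply: continuous_subspaceT => x; exact: smooth_at_cont.
have [M [_ hM]] := compact_bounded cf.
exists (`|M| + 1) => [|l Ll]; first by rewrite addr_ge0.
apply: (hM (`|M| + 1)); last by exists l.
by apply: le_lt_trans (ler_norm M) _; rewrite ltrDl.
Qed.

Lemma contact_space_bounded k (L : set (contact_space R k.+1)) : compact L ->
  exists2 K, 0 <= K & forall l, L l ->
    [/\ `|l.1.1 ord0 ord0| <= K, `|l.1.2 ord0 ord0| <= K & `|l.2| <= K].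
Proof.
move=> cL; have fd : finite_dim ('rV[R]_k.+1 * 'rV[R]_k.+1)%type.
  exact: finite_dimX (finite_dim_rV _) (finite_dim_rV _).
have s1 (l : contact_space R k.+1) := smooth_at_fst l.
have sx l := smooth_at_comp (finite_dim_rV _)
  (smooth_at_comp fd (s1 l) (smooth_at_fst _)) (smooth_at_coord _ ord0).
have sy l := smooth_at_comp (finite_dim_rV _)
  (smooth_at_comp fd (s1 l) (smooth_at_snd _)) (smooth_at_coord _ ord0).
have [A A0 hA] := compact_smooth_bounded cL sx.
have [B B0 hB] := compact_smooth_bounded cL sy.
have [C C0 hC] := compact_smooth_bounded cL (fun l => smooth_at_snd l).
exists (A + B + C) => [|l Ll]; first by rewrite !addr_ge0.
have := hA l Ll; have := hB l Ll; have := hC l Ll => hc hb ha.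
by split; [apply: le_trans ha _|apply: le_trans hb _|apply: le_trans hc _]; lra.
Qed.

Lemma frontspin_family k (L : set (contact_space R k.+1)) a lam K :
  frontspin (translate_x1 a @` L) =
  suspension_family (k := k) (fun t => 1 - t + t * lam)
    (fun q => spin_turn ((1 - q.1) * a + q.1 + 6 * K * q.1 * (1 - q.1)) q.1 q.2.1 q.2.2)
    0 @` (unit_circle `*` L).
Proof.
have E theta (l : contact_space R k.+1) :
  (spin theta (translate_x1 a l).1.1, spin theta (translate_x1 a l).1.2,
   (translate_x1 a l).2) =
  suspension_family (k := k) (fun t => 1 - t + t * lam)
    (fun q => spin_turn ((1 - q.1) * a + q.1 + 6 * K * q.1 * (1 - q.1)) q.1 q.2.1 q.2.2)
    0 ((cos theta, sin theta), l).
  rewrite /suspension_family /suspend /spin_turn /spin_radius /turn_norm /lead /=.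
  rewrite /spin /translate_x1 /=.
  congr (_, _, _); last by field.
    apply: (congr2 (@row_mx R 1 1 k.+1)); apply/rowP => j; rewrite !mxE /=; first by field.
    by case: (eqVneq j ord0) => _ /=; field.
  apply: (congr2 (@row_mx R 1 1 k.+1)); apply/rowP => j; rewrite !mxE /=; first by field.
  by case: (eqVneq j ord0) => _ /=; field.
rewrite eqEsubset; split=> [_ [_ [theta [[l Ll <-] th ->]]]|_ [[p l] [/= Cp Ll] <-]].
  exists ((cos theta, sin theta), l); last by rewrite E.
  by split=> //=; apply/unit_circle_cos_sin; exists theta.
have [theta th pE] := (unit_circle_cos_sin p).1 Cp.
exists (translate_x1 a l), theta; split=> //.
by rewrite pE -E.
Qed.

Lemma legendrian_product_family k (L : set (contact_space R k.+1))
    (W : set (contact_space R 1)) (c b lam : R) (h : R * R -> R) :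
  W = [set (whitney_immersion c p, h p) | p in unit_circle] ->
  (forall p, unit_circle p -> h p = b - c ^+ 2 * p.2 ^+ 3 / 3) ->
  suspension_family (k := k) (fun t => lam + t * (1 - lam))
    (fun q => whitney_product (1 + q.1 * (c - 1)) (q.1 * b) q.2.1 q.2.2)
    1 @` (unit_circle `*` L) = (legendrian_product W L : set (contact_space R k.+2)).
Proof.
move=> WE hE.
have E p (l : contact_space R k.+1) : unit_circle p ->
  suspension_family (k := k) (fun t => lam + t * (1 - lam))
    (fun q => whitney_product (1 + q.1 * (c - 1)) (q.1 * b) q.2.1 q.2.2) 1 (p, l) =
  (row_mx (whitney_immersion c p).1 l.1.1, row_mx (whitney_immersion c p).2 l.1.2,
   h p + l.2).
  move=> Cp; rewrite /suspension_family /suspend /whitney_product /lead /=.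
  rewrite /whitney_immersion hE//=.
  congr (_, _, _); last by field.
    apply: (congr2 (@row_mx R 1 1 k.+1)); apply/rowP => j; rewrite !mxE /=; first by ring.
    by case: ifPn => [/eqP ->|_]; ring.
  apply: (congr2 (@row_mx R 1 1 k.+1)); apply/rowP => j; rewrite !mxE /=; first by ring.
  by case: ifPn => [/eqP ->|_]; ring.
rewrite eqEsubset; split=> [_ [[p l] [/= Cp Ll] <-]|_ [w [l [Ww Ll ->]]]].
  exists (whitney_immersion c p, h p), l; split=> //; last exact: E.
  by rewrite WE; exists p.
move: Ww; rewrite WE => -[p Cp <-].
by exists (p, l) => //; exact: E.
Qed.

End assembly.

(** * The isotopy *)

Section glue.
Context {R : realType}.

Lemma spin_turn1 p w : 1 + w.2 != 0 ->
  spin_turn (1 : R) 1 p w = unwind 1 p w.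
Proof.
case: p w => p1 p2 [u v] /= v0.
rewrite /spin_turn /unwind /spin_radius /turn_norm /=.
by congr (_, _, (_, _), _); field.
Qed.

Lemma unwind0 p w : unwind (0 : R) p w = whitney_product 1 0 p w.
Proof.
case: p w => p1 p2 [u v].
rewrite /unwind /whitney_product /= !expr0n /=.
by congr (_, _, (_, _), _); field.
Qed.

End glue.

Unset Implicit Arguments.
Set Strict Implicit.

(* With n = k + 2, the ambient spaces R^(2n-1) and R^(2n+1) are
   contact_space R k.+1 and contact_space R k.+2. *)
Theorem corollary1p5 (R : realType) :
  exists2 eps : R, 0 < eps &
    forall (k : nat) (L : set (contact_space R k.+1))
           (W : set (contact_space R 1)) (a : R),
      closed_legendrian L ->
      (forall c, reeb_chord L c -> action c < eps) ->
      whitney_unknot W ->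
      (forall p, (translate_x1 a @` L) p -> 0 < p.1.1 ord0 ord0) ->
      legendrian_isotopic (frontspin (translate_x1 a @` L))
                          (legendrian_product W L : set (contact_space R k.+2)).
Proof.
(* The whole length of the chord of [W] is available. *)
exists 1 => // k L W a cL chords [c c0 [[lW [h [sh WE]]] _ act]] pos.
have [b hE] := whitney_height lW sh WE.
have c2 := whitney_scale c0 WE hE act.
have [K K0 bounds] := contact_space_bounded cL.2.
(* The size to which [L] is shrunk before the unwinding. *)
pose lam : R := (8 * (K + 1))^-1.
have K8 : 0 < 8 * (K + 1) by lra.
have lam0 : 0 < lam by rewrite invr_gt0.
have lamK : lam * (8 * (K + 1)) = 1 by rewrite /lam mulVf// gt_eqF.
have lam8 : lam <= 1 / 8 by nra.
have lamK8 : lam * K <= 1 / 8 by nra.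
have lx (l : contact_space R k.+1) : L l -> 0 < l.1.1 ord0 ord0 + a.
  move=> Ll; have := pos (translate_x1 a l) (ex_intro2 _ _ _ Ll erefl).
  by rewrite /translate_x1 /= !mxE eqxx mulr1.
have small l : L l -> `|lam * l.1.2 ord0 ord0| <= 1 / 8 /\ `|lam ^+ 2 * l.2| <= 1 / 8.
  move=> /bounds[_ yK zK]; split.
    by rewrite normrM gtr0_norm//; apply: le_trans lamK8; rewrite ler_pM2l.
  rewrite normrM normrX gtr0_norm// expr2 -mulrA.
  have : lam * `|l.2| <= lam * K by rewrite ler_pM2l.
  have : 0 <= lam * `|l.2| by rewrite mulr_ge0// ltW.
  by move: (lam * _) => r r0 r1; nra.
have sid (t : R) : smooth_at t (fun t : R => t) := smooth_at_id t.
rewrite (frontspin_family L a lam K) -(legendrian_product_family L lam WE hE).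
apply: legendrian_isotopic_trans.
  apply: (@spin_isotopy _ k L (fun t => 1 - t + t * lam)
    (fun t => (1 - t) * a + t + 6 * K * t * (1 - t))) => //.
  - by move=> t; have st := sid t; smooth.
  - by move=> t; have st := sid t; smooth.
  - by move=> t /andP[t0 t1]; rewrite gt_eqF//; nra.
  - move=> t l t01 Ll; have [xK yK _] := bounds l Ll.
    apply: spin_radius_gt0 => //; [|by lra|exact: lx].
    by apply/andP; split; lra.
rewrite [X in legendrian_isotopic X _](_ : _ = suspension_family (k := k) (fun=> lam)
    (fun q => unwind (1 - q.1) q.2.1 q.2.2) 0 @` (unit_circle `*` L)).
  apply: legendrian_isotopic_trans; first exact: unwind_isotopy.
  rewrite [X in legendrian_isotopic X _](_ : _ = suspension_family (k := k)
    (fun t => lam + t * (1 - lam))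
    (fun q => whitney_product (1 + q.1 * (c - 1)) (q.1 * b) q.2.1 q.2.2)
    0 @` (unit_circle `*` L)).
    apply: (@product_isotopy _ k L (fun t => lam + t * (1 - lam))
      (fun t => 1 + t * (c - 1)) (fun t => t * b)) => //.
    - by move=> t; have st := sid t; smooth.
    - by move=> t; have st := sid t; smooth.
    - by move=> t; have st := sid t; smooth.
    - move=> t /andP[t0 t1].
      have c2' : c <= 2 by nra.
      have g0 : 0 < 1 + t * (c - 1) by nra.
      have k0 : 0 < lam + t * (1 - lam) by nra.
      split=> //; rewrite -c2 -mulrA ler_pM2l// -exprMn.
      have kc : c * (lam + t * (1 - lam)) <= 1 + t * (c - 1).
        have : (1 - t) * (c * lam) <= (1 - t) * 1 by apply: ler_wpM2l; nra.
        by lra.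
      by apply: lerXn2r; rewrite // nnegrE ?mulr_ge0 ?(ltW g0) ?(ltW c0) ?(ltW k0).
  apply: eq_imagel => -[p l] [/= Cp Ll]; rewrite /suspension_family /=.
  by rewrite subrr !mul0r !addr0 unwind0.
apply: eq_imagel => -[p l] [/= Cp Ll]; rewrite /suspension_family /=.
have -> : 1 - 1 + 1 * lam = lam by ring.
have -> : (1 - 1) * a + 1 + 6 * K * 1 * (1 - 1) = 1 by ring.
rewrite spin_turn1 ?subr0//.
have [] := small l Ll; rewrite ler_norml => /andP[v0 _] _.
by rewrite gt_eqF// /lead /=; lra.
Qed.
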